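(* For $x>0$, $t>0$ and $n=1,2,3,\ldots$ let $$u_n(x,t):=\frac{\partial^n v(x,t)}{\partial t^n},\qquad v(x,t)=\frac{i}{\pi}\int_{\gamma}\big[e^{i\lambda x-\lambda^2t}-e^{i\lambda x}\big]\frac{d\lambda}{\lambda}.$$ Then $$u_n(x,t)=-\frac{i}{\pi}\int_{-\infty}^{\infty}(-\lambda^2)^{n-1}e^{i\lambda x-\lambda^2t}\lambda\,d\lambda=\frac{x}{2\sqrt{\pi}}\,\frac{\partial^{n-1}}{\partial t^{n-1}}\left(\frac{1}{t\sqrt t}\,e^{-x^2/4t}\right),$$ and each $u=u_n$ solves the initial-boundary-value problem $$u_t=u_{xx}\ (x>0,\ t>0),\qquad \lim_{x\to0^+}u(x,t)=0\ (t>0),\qquad \lim_{t\to0^+}u(x,t)=0\ (x>0).$$ Moreover $u_1\not\equiv0$; thus this problem does not have a unique solution.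
   Context: The contour $\gamma$ is the oriented boundary of $\{\lambda\in\mathbb{C}:\operatorname{Im}\lambda\ge0,\ \operatorname{Re}(\lambda^2)\le0\}=\{\lambda:\pi/4\le\arg\lambda\le3\pi/4\}\cup\{0\}$. It is traversed with this domain on the left, i.e. from $\infty e^{3\pi i/4}$ along a ray to $0$ and then from $0$ along a ray to $\infty e^{\pi i/4}$. *)

(* Defs.v *)
From Stdlib Require Export Reals.
From Coquelicot Require Export Coquelicot.

Open Scope R_scope.
Open Scope C_scope.

Definition Cexp (z : C) : C :=
  (exp (Re z) * cos (Im z), exp (Re z) * sin (Im z))%R.

(* Derivatives of a complex-valued function of a real variable, taken on the
   real and imaginary parts. *)
Definition CDerive_n (f : R -> C) (n : nat) (s : R) : C :=
  (Derive_n (fun r => Re (f r)) n s, Derive_n (fun r => Im (f r)) n s).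

(* [ex_derive_n g n s] alone only says that the total function
   [Derive_n g (n - 1)] is differentiable at [s]; it is required here for all
   lower orders as well, near [s]. *)
Definition ex_Derive_n_near (g : R -> R) (n : nat) (s : R) : Prop :=
  locally s (fun r => forall k, (k <= n)%nat -> ex_derive_n g k r).

Definition ex_CDerive_n (f : R -> C) (n : nat) (s : R) : Prop :=
  ex_Derive_n_near (fun r => Re (f r)) n s /\
  ex_Derive_n_near (fun r => Im (f r)) n s.

Definition line_integrand (f : C -> C) (p : R -> C) (s : R) : C :=
  f (p s) * CDerive_n p 1 s.

(* Improper integral of [f] along a path parametrized by the whole real line;
   both limits are taken independently. *)
Definition ex_path_int (f : C -> C) (p : R -> C) : Prop :=
  ex_RInt_gen (V := C_R_NormedModule) (line_integrand f p)
    (Rbar_locally m_infty) (Rbar_locally p_infty).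

Definition path_int (f : C -> C) (p : R -> C) : C :=
  RInt_gen (V := C_R_CompleteNormedModule) (line_integrand f p)
    (Rbar_locally m_infty) (Rbar_locally p_infty).

(* The set Im z >= 0, Re (z^2) <= 0 is { |Re z| <= Im z }, with boundary
   Im z = |Re z|.  As s increases, [gamma s] = s + i|s| comes in along the ray
   arg z = 3 pi/4, reaches 0 at s = 0, and leaves along arg z = pi/4, so the
   set lies on the left.  The value of the integrand at the corner s = 0 is
   irrelevant to the integral. *)
Definition gamma (s : R) : C := (s, Rabs s).

Definition v_integrand (x t : R) (z : C) : C :=
  (Cexp (Ci * z * x - z ^ 2 * t) - Cexp (Ci * z * x)) / z.

Definition v (x t : R) : C :=
  Ci / PI * path_int (v_integrand x t) gamma.

Definition u (n : nat) (x t : R) : C := CDerive_n (v x) n t.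

Definition u_integrand (n : nat) (x t : R) (z : R) : C :=
  (- z ^ 2) ^ (n - 1) * Cexp (Ci * z * x - z ^ 2 * t) * z.

Definition heat_profile (x t : R) : R :=
  (1 / (t * sqrt t) * exp (- (x ^ 2) / (4 * t)))%R.

Definition solves_ibvp (w : R -> R -> C) : Prop :=
  (forall x t : R, (0 < x)%R -> (0 < t)%R ->
     ex_CDerive_n (fun s => w x s) 1 t /\
     ex_CDerive_n (fun y => w y t) 2 x /\
     CDerive_n (fun s => w x s) 1 t = CDerive_n (fun y => w y t) 2 x) /\
  (forall t : R, (0 < t)%R ->
     filterlim (fun x => w x t) (at_right 0) (locally (RtoC 0))) /\
  (forall x : R, (0 < x)%R ->
     filterlim (fun t => w x t) (at_right 0) (locally (RtoC 0))).

(* Solutions are functions on the open quadrant: values elsewhere are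
   ignored. *)
Definition ibvp_uniquely_solvable : Prop :=
  exists w, solves_ibvp w /\
    forall w', solves_ibvp w' ->
      forall x t : R, (0 < x)%R -> (0 < t)%R -> w' x t = w x t.

(* Main.v *)
(* Parametrizing both rays of the contour, the real parts of the integrand cancel and
   [v = - (2 / PI) * int_0^oo e^(-r x) (sin (r x - 2 r^2 t) - sin (r x)) / r dr].  Its
   [t]-derivative is an integral along the ray [arg = PI / 4], which is rotated onto the real
   axis through the rays [z = r (1 + i s)], [0 <= s <= 1]; this gives
   [(2 / PI) * int_0^oo r e^(-r^2 t) sin (r x) dr], a Gaussian integral equal to a multiple
   of [heat_profile].  The integrals [int_0^oo (-r^2)^(n-1) r e^(-r^2 t) sin (r x) dr] can be
   differentiated freely in [x] and [t], whence the heat equation and the limit at [x = 0];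
   the closed form gives the limit at [t = 0].  Both [0] and [u_1 <> 0] solve the problem. *)
From Stdlib Require Import Lra Lia.
Require Import Defs.

Open Scope R_scope.

(** * Integrals over the half-line *)

(** The available decay decides where each operation is done. On the contour rays z^2 is imaginary,
    so e^(-z^2 t) has modulus 1 and convergence comes from e^(-r x) alone, which is lost as x tends
    to 0. On the real axis the decay comes from e^(-r^2 t), uniformly in x, but it is lost as t
    tends to 0. The integral [v] itself is not moved to the real axis, since its term e^(i z x) / z
    does not decay there; one derivative in t removes both this term and the factor 1 / z.

    The rotation is a real-variable computation: with z = r (1 + i s), an identity d/ds h = d/dr q
    turns the s-derivative of a truncated integral into a boundary term. The same principle yields
    the Gaussian integral. Differentiation under the improper integral is quantitative: the
    integrands concerned lie in the class [exp_decay], and a Taylor remainder at most (y - x)^2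
    g(r), with g in that class, can be integrated as it stands. *)

Definition is_half_int (f : R -> R) (l : R) : Prop :=
  is_lim (fun b => RInt f 0 b) p_infty l.

Definition half_int (f : R -> R) : R := real (Lim (fun b => RInt f 0 b) p_infty).

(** Continuity is asked on the whole line, so that integrability on every interval needs no side
    condition; the bound matters only on the half-line of integration. *)
Definition exp_decay (f : R -> R) : Prop :=
  (forall r, continuous f r) /\
  exists M c, 0 < c /\ forall r, 0 <= r -> Rabs (f r) <= M * exp (- (c * r)).

Lemma ex_derive_continuous_R (f : R -> R) (r : R) : ex_derive f r -> continuous f r.
Proof. apply (ex_derive_continuous (V := R_NormedModule)). Qed.

Lemma continuous_ex_RInt (f : R -> R) (a b : R) :
  (forall r, continuous f r) -> ex_RInt f a b.
Proof. intros H; apply (ex_RInt_continuous (V := R_CompleteNormedModule)); auto. Qed.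

Lemma RInt_minus_Chasles (f : R -> R) (a b c : R) : (forall r, continuous f r) ->
  RInt f a c - RInt f a b = RInt f b c.
Proof.
  intros Hf.
  assert (H := RInt_Chasles f a b c (continuous_ex_RInt f a b Hf) (continuous_ex_RInt f b c Hf)).
  assert (E : forall p q r : R, plus p q = r -> r - p = q) by (intros p q r <-; unfold plus; simpl; ring).
  apply E, H.
Qed.

Lemma is_RInt_derive_all (f df : R -> R) (a b : R) :
  (forall r, is_derive f r (df r)) -> (forall r, continuous df r) ->
  is_RInt df a b (f b - f a).
Proof. intros H H'; apply (is_RInt_derive f df); auto. Qed.

Lemma RInt_abs_le (f g : R -> R) (a b : R) :
  a <= b -> (forall r, continuous f r) -> (forall r, continuous g r) ->
  (forall r, a <= r <= b -> Rabs (f r) <= g r) ->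
  Rabs (RInt f a b) <= RInt g a b.
Proof.
  intros Hab Hf Hg H.
  apply Rle_trans with (RInt (fun r => Rabs (f r)) a b).
  - apply abs_RInt_le; auto using continuous_ex_RInt.
  - apply RInt_le; auto using continuous_ex_RInt.
    + apply continuous_ex_RInt; intros r.
      apply (continuous_comp f Rabs); auto; apply continuous_Rabs.
    + intros r Hr; apply H; lra.
Qed.

Lemma RInt_exp_neg (M c a b : R) : 0 < c ->
  RInt (fun r => M * exp (- (c * r))) a b =
  M / c * (exp (- (c * a)) - exp (- (c * b))).
Proof.
  intros Hc; apply is_RInt_unique.
  replace (M / c * (exp (- (c * a)) - exp (- (c * b))))
    with (- M / c * exp (- (c * b)) - (- M / c * exp (- (c * a)))) by (field; lra).
  apply (is_RInt_derive_all (fun r => - M / c * exp (- (c * r)))).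
  - intros r; auto_derive; trivial; field; lra.
  - intros r; apply ex_derive_continuous_R; auto_derive; trivial.
Qed.

Lemma is_lim_exp_neg (c : R) : 0 < c -> is_lim (fun r => exp (- (c * r))) p_infty 0.
Proof.
  intros Hc.
  apply (is_lim_comp exp (fun r => - (c * r)) p_infty 0 m_infty).
  - apply is_lim_exp_m.
  - evar_last.
    + apply is_lim_opp, is_lim_scal_l, is_lim_id.
    + simpl; destruct (Rle_dec 0 c) as [H|]; [|lra].
      destruct (Rle_lt_or_eq_dec 0 c H); [easy|lra].
  - exists 0; easy.
Qed.

Lemma is_lim_p_infty_le (f : R -> R) (g : R -> R) :
  (forall r, 0 <= r -> Rabs (f r) <= g r) -> is_lim g p_infty 0 -> is_lim f p_infty 0.
Proof.
  intros H Hg.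
  apply (is_lim_le_le_loc (fun r => - g r) g).
  - exists 0; intros r Hr; apply Rabs_le_between, H; lra.
  - evar_last; [apply is_lim_opp, Hg|]; simpl; f_equal; ring.
  - exact Hg.
Qed.

Lemma exp_decay_lim (f : R -> R) : exp_decay f -> is_lim f p_infty 0.
Proof.
  intros (_ & M & c & Hc & H).
  apply (is_lim_p_infty_le _ _ H).
  evar_last; [apply is_lim_scal_l, is_lim_exp_neg, Hc|].
  simpl; f_equal; ring.
Qed.

(** Cauchy criterion: the integral over [u, v] is at most M / c * e^(-c u), which is small once u is
    large. *)
Lemma exp_decay_half_int (f : R -> R) : exp_decay f -> is_half_int f (half_int f).
Proof.
  intros (Hf & M & c & Hc & Hb); unfold half_int.
  apply Lim_correct'.
  change (exists l : R, filterlim (fun b => RInt f 0 b) (Rbar_locally p_infty) (locally l)).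
  apply (filterlim_locally_cauchy (U := R_CompleteSpace)); intros eps.
  assert (HM : is_lim (fun r => M / c * exp (- (c * r))) p_infty 0).
  { evar_last; [apply is_lim_scal_l, is_lim_exp_neg, Hc|].
    simpl; f_equal; ring. }
  assert (Hm : 0 <= M).
  { generalize (Hb 0 (Rle_refl 0)) (Rabs_pos (f 0)).
    rewrite Rmult_0_r, Ropp_0, exp_0; lra. }
  apply is_lim_spec in HM.
  destruct (HM eps) as [N HN]; clear HM.
  exists (fun r => Rmax 0 N < r); split; [exists (Rmax 0 N); auto|].
  assert (Hwlog : forall u v, Rmax 0 N < u -> u <= v ->
    Rabs (RInt f 0 v - RInt f 0 u) < eps).
  { intros u v Hu Huv.
    assert (0 <= u) by (apply Rle_trans with (Rmax 0 N); [apply Rmax_l|lra]).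
    assert (N < u) by (apply Rle_lt_trans with (Rmax 0 N); [apply Rmax_r|lra]).
    replace (RInt f 0 v - RInt f 0 u) with (RInt f u v).
    2:{ symmetry; apply RInt_minus_Chasles; auto. }
    eapply Rle_lt_trans.
    - apply RInt_abs_le with (g := fun r => M * exp (- (c * r))); auto.
      + intros r; apply ex_derive_continuous_R; auto_derive; trivial.
      + intros r Hr; apply Hb; lra.
    - rewrite RInt_exp_neg by auto.
      specialize (HN u H0); rewrite Rminus_0_r in HN.
      assert (0 <= M / c) by (apply Rmult_le_pos; [lra|left; apply Rinv_0_lt_compat; lra]).
      rewrite Rabs_pos_eq in HN by (apply Rmult_le_pos; [lra|left; apply exp_pos]).
      rewrite Rmult_minus_distr_l.
      assert (0 <= M / c * exp (- (c * v))) by (apply Rmult_le_pos; [lra|left; apply exp_pos]).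
      lra. }
  intros a b Ha Hb'; change (Rabs (RInt f 0 b - RInt f 0 a) < eps).
  destruct (Rle_dec a b) as [Hab|Hab].
  - apply Hwlog; auto.
  - rewrite Rabs_minus_sym; apply Hwlog; auto; lra.
Qed.

Lemma half_int_unique (f : R -> R) (l : R) : is_half_int f l -> half_int f = l.
Proof. intros H; unfold half_int; now rewrite (is_lim_unique _ _ _ H). Qed.

Lemma is_half_int_ext (f g : R -> R) (l : R) :
  (forall r, 0 < r -> f r = g r) -> is_half_int f l -> is_half_int g l.
Proof.
  intros H; apply is_lim_ext_loc; exists 0; intros b Hb.
  apply RInt_ext; rewrite Rmin_left, Rmax_right by lra; intros r Hr; apply H; lra.
Qed.

Lemma is_half_int_lin (f g : R -> R) (c l m : R) :
  (forall r, continuous f r) -> (forall r, continuous g r) ->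
  is_half_int f l -> is_half_int g m ->
  is_half_int (fun r => f r + c * g r) (l + c * m).
Proof.
  intros Hf Hg Hl Hm.
  apply (is_lim_ext (fun b => RInt f 0 b + c * RInt g 0 b)).
  - intros b; symmetry; apply is_RInt_unique.
    apply (is_RInt_plus f (fun r => c * g r)); [|apply (is_RInt_scal g)];
      apply (RInt_correct (V := R_CompleteNormedModule)), continuous_ex_RInt; auto.
  - apply is_lim_plus' with (lf := l) (lg := c * m); auto.
    apply (is_lim_scal_l _ c _ m Hm).
Qed.

Lemma is_half_int_abs_le (f g : R -> R) (l m : R) :
  (forall r, continuous f r) -> (forall r, continuous g r) ->
  (forall r, 0 <= r -> Rabs (f r) <= g r) ->
  is_half_int f l -> is_half_int g m -> Rabs l <= m.
Proof.
  intros Hf Hg H Hl Hm.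
  apply (is_lim_le_loc (fun b => Rabs (RInt f 0 b)) (fun b => RInt g 0 b) p_infty (Rabs l) m); auto.
  - exists 0; intros b Hb; apply RInt_abs_le; auto; [lra|]; intros r Hr; apply H; lra.
  - apply (is_lim_comp_continuous _ Rabs _ l Hl (continuous_Rabs l)).
Qed.

Lemma exp_decay_le (f g : R -> R) : (forall r, continuous f r) ->
  (forall r, 0 <= r -> Rabs (f r) <= Rabs (g r)) -> exp_decay g -> exp_decay f.
Proof.
  intros Hf H (_ & M & c & Hc & Hg); split; auto.
  exists M, c; split; auto; intros r Hr.
  eapply Rle_trans; [apply H|apply Hg]; auto.
Qed.

Lemma exp_decay_lin (f g : R -> R) (c : R) :
  exp_decay f -> exp_decay g -> exp_decay (fun r => f r + c * g r).
Proof.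
  intros (Hf & M & a & Ha & HM) (Hg & N & b & Hb & HN); split.
  - intros r; apply (continuous_plus f); auto.
    now apply (continuous_scal_r c g).
  - exists (M + Rabs c * N), (Rmin a b); split; [now apply Rmin_glb_lt|].
    assert (HM0 : 0 <= M).
    { generalize (HM 0 (Rle_refl 0)) (Rabs_pos (f 0)); rewrite Rmult_0_r, Ropp_0, exp_0; lra. }
    assert (HN0 : 0 <= N).
    { generalize (HN 0 (Rle_refl 0)) (Rabs_pos (g 0)); rewrite Rmult_0_r, Ropp_0, exp_0; lra. }
    assert (E : forall d r, 0 <= r -> Rmin a b <= d -> exp (- (d * r)) <= exp (- (Rmin a b * r))).
    { intros d r Hr Hd; destruct (Rle_lt_or_eq_dec (- (d * r)) (- (Rmin a b * r))) as [h|h].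
      - apply Ropp_le_contravar, Rmult_le_compat_r; auto.
      - left; now apply exp_increasing.
      - rewrite h; apply Rle_refl. }
    intros r Hr.
    eapply Rle_trans; [apply Rabs_triang|]; rewrite Rabs_mult, Rmult_plus_distr_r, Rmult_assoc.
    apply Rplus_le_compat; [|apply Rmult_le_compat_l; [apply Rabs_pos|]].
    + eapply Rle_trans; [apply HM, Hr|]; apply Rmult_le_compat_l; auto; apply E; auto; apply Rmin_l.
    + eapply Rle_trans; [apply HN, Hr|]; apply Rmult_le_compat_l; auto; apply E; auto; apply Rmin_r.
Qed.

(** Half of the decay rate is spent on the factor r: e^(-c r) is split into two equal factors, and y
    e^(-y) <= 1 with y = c r / 2 absorbs r at the price of the constant 2 / c. *)
Lemma exp_decay_mult_id (f : R -> R) : exp_decay f -> exp_decay (fun r => r * f r).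
Proof.
  intros (Hf & M & c & Hc & H); split.
  - intros r; apply (continuous_mult (fun r => r) f); auto; apply continuous_id.
  - exists (2 / c * M), (c / 2); split; [lra|]; intros r Hr.
    rewrite Rabs_mult, (Rabs_pos_eq r Hr).
    apply Rle_trans with (r * (M * exp (- (c * r)))).
    { apply Rmult_le_compat_l; auto. }
    assert (Hm : 0 <= M).
    { generalize (H 0 (Rle_refl 0)) (Rabs_pos (f 0)); rewrite Rmult_0_r, Ropp_0, exp_0; lra. }
    replace (- (c * r)) with (- (c / 2 * r) + - (c / 2 * r)) by field.
    rewrite exp_plus.
    assert (E : c / 2 * r * exp (- (c / 2 * r)) <= 1).
    { rewrite <- (Rinv_r (exp (c / 2 * r))), exp_Ropp by apply Rgt_not_eq, exp_pos.
      apply Rmult_le_compat_r; [left; apply Rinv_0_lt_compat, exp_pos|].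
      assert (0 <= c / 2 * r) by (apply Rmult_le_pos; lra).
      destruct (Req_dec (c / 2 * r) 0) as [->|]; [rewrite exp_0; lra|].
      left; generalize (exp_ineq1 (c / 2 * r)); lra. }
    replace (r * (M * (exp (- (c / 2 * r)) * exp (- (c / 2 * r))))) with
      (2 / c * M * exp (- (c / 2 * r)) * (c / 2 * r * exp (- (c / 2 * r)))) by (field; lra).
    rewrite <- (Rmult_1_r (2 / c * M * exp (- (c / 2 * r)))) at 2.
    apply Rmult_le_compat_l; auto.
    apply Rmult_le_pos; [|left; apply exp_pos].
    apply Rmult_le_pos; auto; apply Rmult_le_pos; [lra|left; apply Rinv_0_lt_compat, Hc].
Qed.

Lemma exp_decay_ext (f g : R -> R) : (forall r, f r = g r) -> exp_decay f -> exp_decay g.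
Proof.
  intros E Hf; apply exp_decay_le with f; auto.
  - intros r; apply (continuous_ext f); auto; apply Hf.
  - intros r _; rewrite E; apply Rle_refl.
Qed.

Lemma exp_decay_mult_pow (f : R -> R) (k : nat) : exp_decay f -> exp_decay (fun r => r ^ k * f r).
Proof.
  intros Hf; induction k as [|k IH].
  - apply exp_decay_ext with f; auto; intros r; simpl; ring.
  - apply (exp_decay_ext (fun r => r * (r ^ k * f r))).
    + intros r; simpl; ring.
    + now apply exp_decay_mult_id.
Qed.

Lemma exp_decay_scal (f : R -> R) (c : R) : exp_decay f -> exp_decay (fun r => c * f r).
Proof.
  intros H; apply exp_decay_ext with (fun r => f r + (c - 1) * f r).
  - intros r; ring.
  - now apply exp_decay_lin.
Qed.

Lemma exp_decay_exp (c : R) : 0 < c -> exp_decay (fun r => exp (- (c * r))).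
Proof.
  intros Hc; split.
  - intros r; apply ex_derive_continuous_R; auto_derive; trivial.
  - exists 1, c; split; auto; intros r _; rewrite Rabs_pos_eq; [lra|left; apply exp_pos].
Qed.

Lemma exp_le_exp (a b : R) : a <= b -> exp a <= exp b.
Proof.
  intros [H | ->]; [left; now apply exp_increasing|apply Rle_refl].
Qed.

(** Completing the square, (r t - 1/2)^2 / t >= 0 gives r^2 t >= r - 1 / (4 t), hence decay at rate
    1. *)
Lemma exp_decay_gauss (t : R) : 0 < t -> exp_decay (fun r => exp (- (r ^ 2 * t))).
Proof.
  intros Ht; apply (exp_decay_le _ (fun r => exp (/ (4 * t)) * exp (- (1 * r)))).
  - intros r; apply ex_derive_continuous_R; auto_derive; trivial.
  - intros r _; rewrite <- exp_plus, !Rabs_pos_eq by (left; apply exp_pos).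
    apply exp_le_exp.
    assert (0 <= (r * t - / 2) ^ 2 / t).
    { apply Rmult_le_pos; [apply pow2_ge_0|left; now apply Rinv_0_lt_compat]. }
    replace ((r * t - / 2) ^ 2 / t) with (r ^ 2 * t - r + / (4 * t)) in H by (field; lra).
    lra.
  - apply exp_decay_scal, exp_decay_exp; lra.
Qed.

(** * Differentiation under the integral sign *)

Lemma is_derive_quadratic_bound (f : R -> R) (x l d K : R) : 0 < d ->
  (forall y, Rabs (y - x) < d -> Rabs (f y - f x - (y - x) * l) <= (y - x) ^ 2 * K) ->
  is_derive f x l.
Proof.
  intros Hd H; apply is_derive_Reals; intros eps Heps.
  assert (HK : 0 < Rabs K + 1) by (generalize (Rabs_pos K); lra).
  assert (He : 0 < Rmin d (eps / (Rabs K + 1))).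
  { apply Rmin_glb_lt; auto; apply Rdiv_lt_0_compat; auto. }
  exists (mkposreal _ He); simpl; intros h Hh Hlt.
  assert (H1 : Rabs h < d) by (eapply Rlt_le_trans; [apply Hlt|apply Rmin_l]).
  assert (H2 : Rabs h < eps / (Rabs K + 1)) by (eapply Rlt_le_trans; [apply Hlt|apply Rmin_r]).
  specialize (H (x + h)); replace (x + h - x) with h in H by ring.
  specialize (H H1).
  replace ((f (x + h) - f x) / h - l) with ((f (x + h) - f x - h * l) / h) by (field; auto).
  assert (Hp : 0 < Rabs h) by now apply Rabs_pos_lt.
  unfold Rdiv at 1; rewrite Rabs_mult, Rabs_inv.
  apply Rmult_lt_reg_r with (Rabs h); auto.
  rewrite Rmult_assoc, Rinv_l, Rmult_1_r by lra.
  eapply Rle_lt_trans; [apply H|].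
  rewrite <- (pow2_abs h).
  apply Rle_lt_trans with (Rabs h ^ 2 * (Rabs K + 1)).
  { apply Rmult_le_compat_l; [apply pow2_ge_0|generalize (Rle_abs K); lra]. }
  simpl; rewrite Rmult_1_r, Rmult_assoc, (Rmult_comm eps).
  apply Rmult_lt_compat_l; auto.
  apply Rmult_lt_compat_r with (r := Rabs K + 1) in H2; auto.
  replace (eps / (Rabs K + 1) * (Rabs K + 1)) with eps in H2 by (field; lra); lra.
Qed.

(** The pointwise remainder bound is integrated in r and becomes a remainder bound for the integral,
    with constant [half_int g]; the quadratic factor does not depend on r and comes out. *)
Lemma is_derive_half_int (f : R -> R -> R) (f1 g : R -> R) (x d : R) : 0 < d ->
  (forall y, Rabs (y - x) < d -> exp_decay (f y)) -> exp_decay f1 -> exp_decay g ->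
  (forall y r, Rabs (y - x) < d -> 0 <= r ->
     Rabs (f y r - f x r - (y - x) * f1 r) <= (y - x) ^ 2 * g r) ->
  is_derive (fun y => half_int (f y)) x (half_int f1).
Proof.
  intros Hd Hf Hf1 Hg H; apply is_derive_quadratic_bound with d (half_int g); auto.
  intros y Hy.
  assert (Hx : exp_decay (f x)) by (apply Hf; now rewrite Rminus_diag, Rabs_R0).
  assert (Hy' := Hf y Hy).
  assert (D1 := exp_decay_lin _ _ (-1) Hy' Hx).
  assert (D2 := exp_decay_lin _ _ (-(y - x)) D1 Hf1).
  assert (D3 := exp_decay_scal _ ((y - x) ^ 2) Hg).
  eapply is_half_int_abs_le with (f := fun r => f y r + -1 * f x r + - (y - x) * f1 r)
    (g := fun r => (y - x) ^ 2 * g r).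
  - apply D2.
  - apply D3.
  - intros r Hr.
    replace (f y r + -1 * f x r + - (y - x) * f1 r) with (f y r - f x r - (y - x) * f1 r) by ring.
    now apply H.
  - replace (half_int (f y) - half_int (f x) - (y - x) * half_int f1)
      with (half_int (f y) + -1 * half_int (f x) + - (y - x) * half_int f1) by ring.
    apply is_half_int_lin; [apply D1|apply Hf1| |now apply exp_decay_half_int].
    apply is_half_int_lin; [apply Hy'|apply Hx| |]; now apply exp_decay_half_int.
  - apply (is_lim_ext (fun b => (y - x) ^ 2 * RInt g 0 b)).
    + intros b; symmetry; apply is_RInt_unique, (is_RInt_scal g).
      apply (RInt_correct (V := R_CompleteNormedModule)), continuous_ex_RInt, Hg.
    + apply (is_lim_scal_l _ _ _ (half_int g)), exp_decay_half_int, Hg.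
Qed.

(** * Rotation of the contour *)

Ltac continuity_2d :=
  lazymatch goal with
  | |- continuity_2d_pt (fun _ _ => ?c) _ _ => apply continuity_2d_pt_const
  | |- continuity_2d_pt (fun u _ => u) _ _ => apply continuity_2d_pt_id1
  | |- continuity_2d_pt (fun _ v => v) _ _ => apply continuity_2d_pt_id2
  | |- continuity_2d_pt (fun u v => @?f u v + @?g u v) _ _ =>
      apply (continuity_2d_pt_plus f g); continuity_2d
  | |- continuity_2d_pt (fun u v => @?f u v - @?g u v) _ _ =>
      apply (continuity_2d_pt_minus f g); continuity_2d
  | |- continuity_2d_pt (fun u v => @?f u v * @?g u v) _ _ =>
      apply (continuity_2d_pt_mult f g); continuity_2d
  | |- continuity_2d_pt (fun u v => - @?f u v) _ _ =>
      apply (continuity_2d_pt_opp f); continuity_2d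
  | |- continuity_2d_pt (fun u v => (@?f u v) ^ 2) _ _ =>
      apply (continuity_1d_2d_pt_comp (fun z => z ^ 2) f);
      [apply derivable_continuous_pt, derivable_pt_pow|continuity_2d]
  | |- continuity_2d_pt (fun u v => exp (@?f u v)) _ _ =>
      apply (continuity_1d_2d_pt_comp exp f);
      [apply derivable_continuous_pt, derivable_pt_exp|continuity_2d]
  | |- continuity_2d_pt (fun u v => sin (@?f u v)) _ _ =>
      apply (continuity_1d_2d_pt_comp sin f); [apply continuity_sin|continuity_2d]
  | |- continuity_2d_pt (fun u v => cos (@?f u v)) _ _ =>
      apply (continuity_1d_2d_pt_comp cos f); [apply continuity_cos|continuity_2d]
  end.

Lemma continuity_2d_pt_continuous_2 (f : R -> R -> R) (x y : R) :
  continuity_2d_pt f x y -> continuous (f x) y.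
Proof.
  intros H; apply continuity_2d_pt_filterlim in H.
  intros P HP; destruct (H P HP) as [eps Heps].
  exists eps; intros z Hz; apply (Heps (x, z)); split; [apply ball_center|exact Hz].
Qed.

(** A conservation law: [h] is a density and [q] its flux, with common derivative [k] (in s for [h],
    in r for [q]). Integrating [k] over [a, b] leaves only the flux through the endpoints. It serves
    both for the contour rotation and for the Gaussian integral. *)
Lemma is_derive_RInt_conservation (h k q : R -> R -> R) (a b s : R) :
  (forall s r, is_derive (fun s => h s r) s (k s r)) ->
  (forall s r, is_derive (q s) r (k s r)) ->
  (forall s r, continuity_2d_pt k s r) ->
  (forall s r, continuous (h s) r) ->
  is_derive (fun s => RInt (h s) a b) s (q s b - q s a).
Proof.
  intros Hh Hq Hk Hc.
  evar_last.
  - apply is_derive_RInt_param.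
    + apply filter_forall; intros y r _; eexists; apply Hh.
    + intros r _; apply (continuity_2d_pt_ext k); auto.
      intros; symmetry; now apply is_derive_unique.
    + apply filter_forall; intros y; now apply continuous_ex_RInt.
  - apply is_RInt_unique.
    apply (is_RInt_ext (k s)).
    + intros r _; symmetry; now apply is_derive_unique.
    + apply is_RInt_derive_all; auto.
      intros r; now apply continuity_2d_pt_continuous_2.
Qed.

(** With [sector_phase], the modulus and the argument of e^(i z x - z^2 t) at z = r (1 + i s), where
    z^2 = r^2 (1 - s^2 + 2 i s). *)
Definition sector_exp (x t s r : R) : R := exp (- (r * s * x + r ^ 2 * t * (1 - s ^ 2))).

Definition sector_phase (x t s r : R) : R := r * x - 2 * r ^ 2 * t * s.

(* [sector] and [sector_arc] are the imaginary parts of [(1 + i s) f (r (1 + i s))] and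
   [i r f (r (1 + i s))], where [f z = z e^(i z x - z^2 t)]. *)
Definition sector (x t s r : R) : R :=
  r * sector_exp x t s r *
  ((1 - s ^ 2) * sin (sector_phase x t s r) + 2 * s * cos (sector_phase x t s r)).

Definition sector_arc (x t s r : R) : R :=
  r ^ 2 * sector_exp x t s r *
  (cos (sector_phase x t s r) - s * sin (sector_phase x t s r)).

(** Cauchy's theorem in differential form: for z = r (1 + i s), both d/ds of (1 + i s) f z and d/dr
    of i r f z equal i f z + i r (1 + i s) f' z; [k] is the imaginary part of this. The flux at r =
    0 vanishes because of the factor r^2 in [sector_arc]. *)
Lemma is_derive_RInt_sector (x t s b : R) :
  is_derive (fun s => RInt (sector x t s) 0 b) s (sector_arc x t s b).
Proof.
  pose (k := fun s r =>
    r * sector_exp x t s r * (- r * x + 2 * r ^ 2 * t * s) *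
      ((1 - s ^ 2) * sin (sector_phase x t s r) + 2 * s * cos (sector_phase x t s r)) +
    r * sector_exp x t s r *
      (- 2 * s * sin (sector_phase x t s r)
       + (1 - s ^ 2) * (- 2 * r ^ 2 * t) * cos (sector_phase x t s r)
       + 2 * cos (sector_phase x t s r)
       + 4 * s * r ^ 2 * t * sin (sector_phase x t s r))).
  replace (sector_arc x t s b) with (sector_arc x t s b - sector_arc x t s 0)
    by (unfold sector_arc; ring).
  apply is_derive_RInt_conservation with k.
  - intros s' r; unfold k, sector, sector_exp, sector_phase; auto_derive; trivial; unfold Rminus; simpl; ring.
  - intros s' r; unfold k, sector_arc, sector_exp, sector_phase; auto_derive; trivial; unfold Rminus; simpl; ring.
  - intros s' r; unfold k, sector_exp, sector_phase; continuity_2d.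
  - intros s' r; apply continuity_2d_pt_continuous_2.
    unfold sector, sector_exp, sector_phase; continuity_2d.
Qed.

(* Since [r^2 t >= r x - x^2 / (4 t)] and [s + (1 - s^2) >= 1], the exponential decays
   uniformly over the whole sector. *)
Lemma sector_exp_le (x t s r : R) : 0 < x -> 0 < t -> 0 <= s <= 1 -> 0 <= r ->
  sector_exp x t s r <= exp (x ^ 2 / (4 * t)) * exp (- (x * r)).
Proof.
  intros Hx Ht Hs Hr; unfold sector_exp; rewrite <- exp_plus; apply exp_le_exp.
  assert (H : 0 <= (r * t - x / 2) ^ 2 / t).
  { apply Rmult_le_pos; [apply pow2_ge_0|left; now apply Rinv_0_lt_compat]. }
  replace ((r * t - x / 2) ^ 2 / t) with (r ^ 2 * t - r * x + x ^ 2 / (4 * t)) in H by (field; lra).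
  assert (H0 : 0 <= x ^ 2 / (4 * t)).
  { apply Rmult_le_pos; [apply pow2_ge_0|left; apply Rinv_0_lt_compat; lra]. }
  assert (H1 : 0 <= (1 - s ^ 2) * (r ^ 2 * t - r * x + x ^ 2 / (4 * t))) by (apply Rmult_le_pos; auto; nra).
  assert (H2 : 0 <= (s - s ^ 2) * (r * x)) by (apply Rmult_le_pos; [nra|apply Rmult_le_pos; lra]).
  assert (H3 : 0 <= s ^ 2 * (x ^ 2 / (4 * t))) by (apply Rmult_le_pos; auto; apply pow2_ge_0).
  nra.
Qed.

Lemma sector_arc_le (x t s r : R) : 0 < x -> 0 < t -> 0 <= s <= 1 -> 0 <= r ->
  Rabs (sector_arc x t s r) <= 2 * exp (x ^ 2 / (4 * t)) * (r ^ 2 * exp (- (x * r))).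
Proof.
  intros Hx Ht Hs Hr; unfold sector_arc.
  rewrite !Rabs_mult, (Rabs_pos_eq (r ^ 2)) by apply pow2_ge_0.
  rewrite (Rabs_pos_eq (sector_exp x t s r)) by (left; apply exp_pos).
  replace (2 * exp (x ^ 2 / (4 * t)) * (r ^ 2 * exp (- (x * r))))
    with (r ^ 2 * (exp (x ^ 2 / (4 * t)) * exp (- (x * r))) * 2) by ring.
  apply Rmult_le_compat.
  - apply Rmult_le_pos; [apply pow2_ge_0|left; apply exp_pos].
  - apply Rabs_pos.
  - apply Rmult_le_compat_l; [apply pow2_ge_0|now apply sector_exp_le].
  - generalize (COS_bound (sector_phase x t s r)) (SIN_bound (sector_phase x t s r)).
    intros; apply Rabs_le; split; nra.
Qed.

(* Rotating the contour from the real axis [s = 0] to the ray [s = 1]: the two truncated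
   integrals differ by the integral of [sector_arc] over the arc, which tends to 0. *)
Lemma is_half_int_sector (x t l : R) : 0 < x -> 0 < t ->
  is_half_int (sector x t 1) l -> is_half_int (sector x t 0) l.
Proof.
  intros Hx Ht Hl; unfold is_half_int.
  apply (is_lim_ext (fun b => RInt (sector x t 1) 0 b -
    (RInt (sector x t 1) 0 b - RInt (sector x t 0) 0 b))); [intros; ring|].
  replace (Finite l) with (Finite (l - 0)) by (f_equal; ring).
  apply is_lim_minus'; auto.
  apply (is_lim_p_infty_le _ (fun r => 2 * exp (x ^ 2 / (4 * t)) * (r ^ 2 * exp (- (x * r))))).
  - intros b Hb.
    (* The mean value theorem in s stands in for the integral over the arc. The intermediate s
       depends on b, so the bound on [sector_arc] has to be uniform in s. *)
    destruct (MVT_gen (fun s => RInt (sector x t s) 0 b) 0 1 (fun s => sector_arc x t s b))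
      as (s & Hs & E).
    + intros s _; apply is_derive_RInt_sector.
    + intros s _; apply continuity_pt_filterlim, (ex_derive_continuous_R (fun s => RInt (sector x t s) 0 b)).
      eexists; apply is_derive_RInt_sector.
    + rewrite E, Rminus_0_r, Rmult_1_r.
      rewrite Rmin_left, Rmax_right in Hs by lra.
      now apply sector_arc_le.
  - apply exp_decay_lim, exp_decay_scal, exp_decay_mult_pow, exp_decay_exp, Hx.
Qed.

(** * The Gaussian integral *)

Definition gauss (x : R) : R := RInt (fun r => exp (- r ^ 2)) 0 x.

Lemma is_derive_gauss (x : R) : is_derive gauss x (exp (- x ^ 2)).
Proof.
  apply (is_derive_RInt (fun r => exp (- r ^ 2)) gauss 0).
  - apply filter_forall; intros y; apply (RInt_correct (V := R_CompleteNormedModule)), continuous_ex_RInt.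
    intros r; apply ex_derive_continuous_R; auto_derive; trivial.
  - apply ex_derive_continuous_R; auto_derive; trivial.
Qed.

(** The classical companion of the Gaussian integral: the x-derivative of its integral over [0, 1]
    is opposite to that of [gauss x ^ 2]. *)
Definition gauss_aux (x s : R) : R := exp (- x ^ 2 * (1 + s ^ 2)) / (1 + s ^ 2).

(** The x-derivative -2 x e^(-x^2 (1 + s^2)) of [gauss_aux] is also the s-derivative of -2 e^(-x^2)
    gauss(x s), so the conservation law applies with x as parameter and s as integration
    variable. *)
Lemma is_derive_RInt_gauss_aux (x : R) :
  is_derive (fun x => RInt (gauss_aux x) 0 1) x (- 2 * exp (- x ^ 2) * gauss x).
Proof.
  replace (- 2 * exp (- x ^ 2) * gauss x)
    with (- 2 * exp (- x ^ 2) * gauss (x * 1) - - 2 * exp (- x ^ 2) * gauss (x * 0)).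
  2:{ rewrite Rmult_1_r, Rmult_0_r; unfold gauss at 2; rewrite RInt_point; unfold zero; simpl; ring. }
  apply (is_derive_RInt_conservation gauss_aux
    (fun x s => - 2 * x * exp (- x ^ 2 * (1 + s ^ 2)))
    (fun x s => - 2 * exp (- x ^ 2) * gauss (x * s))).
  - intros y s; unfold gauss_aux; auto_derive; [nra|]; simpl; field; nra.
  - intros y s.
    evar_last.
    + apply is_derive_scal, (is_derive_comp gauss (fun s => y * s)).
      * apply is_derive_gauss.
      * auto_derive; trivial.
    + unfold scal; simpl; unfold mult; simpl.
      replace (- (y * (y * 1)) * (1 + s * (s * 1))) with (- (y * (y * 1)) + - (y * s * (y * s * 1))) by ring.
      rewrite exp_plus; ring.
  - intros y s; continuity_2d.
  - intros y s; apply ex_derive_continuous_R; unfold gauss_aux; auto_derive; nra.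
Qed.

(* The sum [gauss x ^ 2 + RInt (gauss_aux x) 0 1] is constant, with value [atan 1] at 0. *)
Lemma gauss_sqr (x : R) : 0 <= x -> gauss x ^ 2 = PI / 4 - RInt (gauss_aux x) 0 1.
Proof.
  intros Hx.
  assert (H0 : gauss 0 ^ 2 + RInt (gauss_aux 0) 0 1 = PI / 4).
  { unfold gauss; rewrite RInt_point.
    replace (RInt (gauss_aux 0) 0 1) with (PI / 4); [unfold zero; simpl; ring|].
    symmetry; apply is_RInt_unique.
    replace (PI / 4) with (atan 1 - atan 0) by (rewrite atan_1, atan_0; ring).
    apply (is_RInt_derive_all atan).
    - intros r; evar_last; [apply is_derive_atan|].
      unfold gauss_aux; rewrite pow_i, Ropp_0, Rmult_0_l, exp_0 by lia.
      unfold Rsqr; simpl; field; nra.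
    - intros r; apply ex_derive_continuous_R; unfold gauss_aux; auto_derive; nra. }
  destruct Hx as [Hx | <-]; [|lra].
  assert (E := eq_is_derive (fun x => gauss x ^ 2 + RInt (gauss_aux x) 0 1) 0 x).
  simpl in E; rewrite <- H0; simpl; rewrite E; auto; [ring|].
  intros y _.
  evar_last.
  - apply (is_derive_plus (fun y => gauss y * (gauss y * 1))).
    + apply (is_derive_mult gauss (fun y => gauss y * 1)); [apply is_derive_gauss| |intros; apply Rmult_comm].
      apply (is_derive_mult gauss (fun y => 1)); [apply is_derive_gauss|apply is_derive_const|intros; apply Rmult_comm].
    + apply is_derive_RInt_gauss_aux.
  - unfold plus, mult, zero; simpl; ring.
Qed.

(** On [0, 1] [gauss_aux x] is at most e^(-x^2), so the integral in [gauss_sqr] tends to 0; [gauss]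
    is nonnegative for x > 0, hence equal to the square root of its square. *)
Lemma is_lim_gauss : is_lim gauss p_infty (sqrt PI / 2).
Proof.
  assert (L : is_lim (fun x => RInt (gauss_aux x) 0 1) p_infty 0).
  { apply (is_lim_p_infty_le _ (fun x => exp (- (x ^ 2 * 1)))); [|apply exp_decay_lim, exp_decay_gauss; lra].
    intros x Hx; replace (exp (- (x ^ 2 * 1))) with ((1 - 0) * exp (- (x ^ 2 * 1))) by ring.
    apply abs_RInt_le_const; [lra| |].
    - apply continuous_ex_RInt; intros r; apply ex_derive_continuous_R; unfold gauss_aux; auto_derive; nra.
    - intros r Hr; unfold gauss_aux.
      assert (1 <= 1 + r ^ 2) by nra.
      unfold Rdiv; rewrite Rabs_mult, Rabs_inv, !Rabs_pos_eq; [|lra|left; apply exp_pos].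
      rewrite <- (Rmult_1_r (exp (- (x ^ 2 * 1)))).
      apply Rmult_le_compat.
      + left; apply exp_pos.
      + left; apply Rinv_0_lt_compat; lra.
      + apply exp_le_exp; nra.
      + rewrite <- Rinv_1 at 2; apply Rinv_le_contravar; lra. }
  replace (sqrt PI / 2) with (sqrt (PI / 4 - 0)).
  2:{ rewrite Rminus_0_r, sqrt_div_alt by lra; replace 4 with (2 ^ 2) by ring.
      rewrite sqrt_pow2; lra. }
  apply (is_lim_ext_loc (fun x => sqrt (PI / 4 - RInt (gauss_aux x) 0 1))).
  - exists 0; intros x Hx.
    rewrite <- gauss_sqr by lra; apply sqrt_pow2, RInt_ge_0; [lra| |].
    + apply continuous_ex_RInt; intros r; apply ex_derive_continuous_R; auto_derive; trivial.
    + intros r _; left; apply exp_pos.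
  - apply (is_lim_comp_continuous (fun x => PI / 4 - RInt (gauss_aux x) 0 1) sqrt).
    + apply is_lim_minus'; auto; apply is_lim_const.
    + apply continuous_sqrt.
Qed.

(** Substitution of sqrt t * r for the variable, carried out on the primitive. *)
Lemma is_half_int_gauss (t : R) : 0 < t ->
  is_half_int (fun r => exp (- (r ^ 2 * t))) (sqrt PI / (2 * sqrt t)).
Proof.
  intros Ht; assert (Hs := sqrt_lt_R0 t Ht).
  apply (is_lim_ext (fun b => / sqrt t * gauss (sqrt t * b))).
  - intros b; symmetry; apply is_RInt_unique.
    replace (/ sqrt t * gauss (sqrt t * b))
      with (/ sqrt t * gauss (sqrt t * b) - / sqrt t * gauss (sqrt t * 0)).
    2:{ rewrite Rmult_0_r; unfold gauss at 2; rewrite RInt_point; unfold zero; simpl; ring. }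
    apply (is_RInt_derive_all (fun b => / sqrt t * gauss (sqrt t * b))).
    + intros r; evar_last.
      * apply is_derive_scal, (is_derive_comp gauss (fun s => sqrt t * s)).
        -- apply is_derive_gauss.
        -- auto_derive; trivial.
      * unfold scal; simpl; unfold mult; simpl.
        replace (sqrt t * r * (sqrt t * r * 1)) with (r * (r * 1) * (sqrt t * sqrt t)) by ring.
        rewrite sqrt_sqrt by lra; field; lra.
    + intros r; apply ex_derive_continuous_R; auto_derive; trivial.
  - replace (Finite (sqrt PI / (2 * sqrt t))) with (Rbar_mult (/ sqrt t) (sqrt PI / 2)).
    2:{ simpl; f_equal; field; lra. }
    apply is_lim_scal_l.
    apply (is_lim_comp gauss (fun b => sqrt t * b) p_infty (sqrt PI / 2) p_infty).
    + apply is_lim_gauss.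
    + evar_last; [apply is_lim_scal_l, is_lim_id|].
      simpl; destruct (Rle_dec 0 (sqrt t)) as [H|]; [|lra].
      destruct (Rle_lt_or_eq_dec 0 (sqrt t) H); [easy|lra].
    + exists 0; easy.
Qed.

(** * Moments of the Gaussian *)

Lemma MVT_abs_le (f f' : R -> R) (a b K : R) :
  (forall c, is_derive f c (f' c)) ->
  (forall c, Rmin a b <= c <= Rmax a b -> Rabs (f' c) <= K) ->
  Rabs (f b - f a) <= K * Rabs (b - a).
Proof.
  intros Hf HK.
  destruct (MVT_gen f a b f') as (c & Hc & ->).
  - intros c _; apply Hf.
  - intros c _; apply continuity_pt_filterlim, (ex_derive_continuous_R f); eexists; apply Hf.
  - rewrite Rabs_mult; apply Rmult_le_compat_r; [apply Rabs_pos|auto].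
Qed.

(** Two applications of the mean value theorem. They give the constant K instead of K / 2, which
    suffices for [is_derive_half_int]. *)
Lemma taylor_abs_le (f f' f'' : R -> R) (a b K : R) :
  (forall c, is_derive f c (f' c)) -> (forall c, is_derive f' c (f'' c)) ->
  (forall c, Rmin a b <= c <= Rmax a b -> Rabs (f'' c) <= K) ->
  Rabs (f b - f a - (b - a) * f' a) <= (b - a) ^ 2 * K.
Proof.
  intros Hf Hf' HK.
  destruct (MVT_gen f a b f') as (c & Hc & ->).
  - intros c _; apply Hf.
  - intros c _; apply continuity_pt_filterlim, (ex_derive_continuous_R f); eexists; apply Hf.
  - replace (f' c * (b - a) - (b - a) * f' a) with ((b - a) * (f' c - f' a)) by ring.
    rewrite Rabs_mult, <- (pow2_abs (b - a)).
    replace (Rabs (b - a) ^ 2 * K) with (Rabs (b - a) * (K * Rabs (b - a))) by ring.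
    apply Rmult_le_compat_l; [apply Rabs_pos|].
    assert (K0 : 0 <= K) by (apply Rle_trans with (2 := HK c Hc), Rabs_pos).
    apply Rle_trans with (K * Rabs (c - a)).
    + apply (MVT_abs_le f' f''); auto.
      intros d Hd; apply HK.
      revert Hc Hd; unfold Rmin, Rmax; repeat destruct Rle_dec; lra.
    + apply Rmult_le_compat_l; auto.
      revert Hc; unfold Rmin, Rmax, Rabs; destruct Rle_dec; repeat destruct Rcase_abs; lra.
Qed.

Lemma sin_abs_le_1 (a : R) : Rabs (sin a) <= 1.
Proof. apply Rabs_le, SIN_bound. Qed.

Lemma cos_abs_le_1 (a : R) : Rabs (cos a) <= 1.
Proof. apply Rabs_le, COS_bound. Qed.

Lemma sin_lipschitz (a b : R) : Rabs (sin b - sin a) <= Rabs (b - a).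
Proof.
  rewrite <- (Rmult_1_l (Rabs (b - a))).
  apply (MVT_abs_le sin cos); [apply is_derive_sin|intros; apply cos_abs_le_1].
Qed.

Lemma cos_lipschitz (a b : R) : Rabs (cos b - cos a) <= Rabs (b - a).
Proof.
  rewrite <- (Rmult_1_l (Rabs (b - a))).
  apply (MVT_abs_le cos (fun c => - sin c)); [apply is_derive_cos|].
  intros; rewrite Rabs_Ropp; apply sin_abs_le_1.
Qed.

Lemma sin_taylor (a b : R) : Rabs (sin b - sin a - (b - a) * cos a) <= (b - a) ^ 2.
Proof.
  rewrite <- (Rmult_1_r ((b - a) ^ 2)).
  apply (taylor_abs_le sin cos (fun c => - sin c)); [apply is_derive_sin|apply is_derive_cos|].
  intros; rewrite Rabs_Ropp; apply sin_abs_le_1.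
Qed.

Lemma cos_taylor (a b : R) : Rabs (cos b - cos a - (b - a) * - sin a) <= (b - a) ^ 2.
Proof.
  rewrite <- (Rmult_1_r ((b - a) ^ 2)).
  apply (taylor_abs_le cos (fun c => - sin c) (fun c => - cos c)); [apply is_derive_cos| |].
  - intros c; auto_derive; trivial; ring.
  - intros; rewrite Rabs_Ropp; apply cos_abs_le_1.
Qed.

Definition sin_moment (p : nat) (x t r : R) : R := r ^ p * exp (- (r ^ 2 * t)) * sin (r * x).

Definition cos_moment (p : nat) (x t r : R) : R := r ^ p * exp (- (r ^ 2 * t)) * cos (r * x).

Lemma exp_decay_gauss_moment (p : nat) (t : R) : 0 < t ->
  exp_decay (fun r => r ^ p * exp (- (r ^ 2 * t))).
Proof. intros Ht; now apply exp_decay_mult_pow, exp_decay_gauss. Qed.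

Lemma exp_decay_mult_bounded (f g : R -> R) : (forall r, continuous g r) ->
  (forall r, Rabs (g r) <= 1) -> exp_decay f -> exp_decay (fun r => f r * g r).
Proof.
  intros Hg H Hf; apply exp_decay_le with f; auto.
  - intros r; apply (continuous_mult f g); auto; apply Hf.
  - intros r _; rewrite Rabs_mult; generalize (H r) (Rabs_pos (f r)); nra.
Qed.

Lemma exp_decay_sin_moment (p : nat) (x t : R) : 0 < t -> exp_decay (sin_moment p x t).
Proof.
  intros Ht; apply (exp_decay_mult_bounded _ (fun r => sin (r * x))).
  - intros r; apply ex_derive_continuous_R; auto_derive; trivial.
  - intros; apply sin_abs_le_1.
  - now apply exp_decay_gauss_moment.
Qed.

Lemma exp_decay_cos_moment (p : nat) (x t : R) : 0 < t -> exp_decay (cos_moment p x t).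
Proof.
  intros Ht; apply (exp_decay_mult_bounded _ (fun r => cos (r * x))).
  - intros r; apply ex_derive_continuous_R; auto_derive; trivial.
  - intros; apply cos_abs_le_1.
  - now apply exp_decay_gauss_moment.
Qed.

Lemma half_int_scal (f : R -> R) (c : R) : exp_decay f ->
  half_int (fun r => c * f r) = c * half_int f.
Proof.
  intros Hf; apply half_int_unique.
  replace (c * half_int f) with (half_int f + (c - 1) * half_int f) by ring.
  apply (is_half_int_ext (fun r => f r + (c - 1) * f r)); [intros; ring|].
  apply is_half_int_lin; try apply Hf; now apply exp_decay_half_int.
Qed.

(** The Taylor remainder of sin between r x and r y is at most r^2 (y - x)^2, whence the exponent p
    + 2 in the dominating function. *)
Lemma is_derive_sin_moment_x (p : nat) (x t : R) : 0 < t ->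
  is_derive (fun y => half_int (sin_moment p y t)) x (half_int (cos_moment (S p) x t)).
Proof.
  intros Ht.
  apply is_derive_half_int with (g := fun r => r ^ (p + 2) * exp (- (r ^ 2 * t))) (d := 1); [lra| | | |].
  - intros y _; now apply exp_decay_sin_moment.
  - now apply exp_decay_cos_moment.
  - now apply exp_decay_gauss_moment.
  - intros y r _ Hr; unfold sin_moment, cos_moment.
    assert (H0 : 0 <= r ^ p * exp (- (r ^ 2 * t))).
    { apply Rmult_le_pos; [now apply pow_le|left; apply exp_pos]. }
    replace (_ - _ - _) with (r ^ p * exp (- (r ^ 2 * t)) *
      (sin (r * y) - sin (r * x) - (r * y - r * x) * cos (r * x))) by (simpl; ring).
    replace ((y - x) ^ 2 * (r ^ (p + 2) * exp (- (r ^ 2 * t)))) with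
      (r ^ p * exp (- (r ^ 2 * t)) * (r * y - r * x) ^ 2) by (rewrite pow_add; ring).
    rewrite Rabs_mult, Rabs_pos_eq by auto.
    apply Rmult_le_compat_l; auto; apply sin_taylor.
Qed.

Lemma is_derive_cos_moment_x (p : nat) (x t : R) : 0 < t ->
  is_derive (fun y => half_int (cos_moment p y t)) x (- half_int (sin_moment (S p) x t)).
Proof.
  intros Ht.
  replace (- half_int (sin_moment (S p) x t)) with (-1 * half_int (sin_moment (S p) x t)) by ring.
  rewrite <- half_int_scal by now apply exp_decay_sin_moment.
  apply is_derive_half_int with (g := fun r => r ^ (p + 2) * exp (- (r ^ 2 * t))) (d := 1); [lra| | | |].
  - intros y _; now apply exp_decay_cos_moment.
  - now apply exp_decay_scal, exp_decay_sin_moment.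
  - now apply exp_decay_gauss_moment.
  - intros y r _ Hr; unfold sin_moment, cos_moment.
    assert (H0 : 0 <= r ^ p * exp (- (r ^ 2 * t))).
    { apply Rmult_le_pos; [now apply pow_le|left; apply exp_pos]. }
    replace (_ - _ - _) with (r ^ p * exp (- (r ^ 2 * t)) *
      (cos (r * y) - cos (r * x) - (r * y - r * x) * - sin (r * x))) by (simpl; ring).
    replace ((y - x) ^ 2 * (r ^ (p + 2) * exp (- (r ^ 2 * t)))) with
      (r ^ p * exp (- (r ^ 2 * t)) * (r * y - r * x) ^ 2) by (rewrite pow_add; ring).
    rewrite Rabs_mult, Rabs_pos_eq by auto.
    apply Rmult_le_compat_l; auto; apply cos_taylor.
Qed.

Lemma is_derive_sin_moment_t (p : nat) (x t : R) : 0 < t ->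
  is_derive (fun s => half_int (sin_moment p x s)) t (- half_int (sin_moment (p + 2) x t)).
Proof.
  intros Ht.
  replace (- half_int (sin_moment (p + 2) x t)) with (-1 * half_int (sin_moment (p + 2) x t)) by ring.
  rewrite <- half_int_scal by now apply exp_decay_sin_moment.
  (* Staying within t / 2 of t keeps the Gaussian below the fixed one at time t / 2; two
     t-derivatives of e^(-r^2 s) bring down the factor r^4 of the dominating function. *)
  assert (Hd : forall s, Rabs (s - t) < t / 2 -> t / 2 < s).
  { intros s Hs; apply Rabs_lt_between in Hs; lra. }
  apply is_derive_half_int with (g := fun r => r ^ (p + 4) * exp (- (r ^ 2 * (t / 2)))) (d := t / 2); [lra| | | |].
  - intros s Hs; apply exp_decay_sin_moment; generalize (Hd s Hs); lra.
  - now apply exp_decay_scal, exp_decay_sin_moment.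
  - apply exp_decay_gauss_moment; lra.
  - intros s r Hs Hr; specialize (Hd s Hs); unfold sin_moment.
    replace (_ - _ - _) with (sin (r * x) * (r ^ p *
      (exp (- (r ^ 2 * s)) - exp (- (r ^ 2 * t)) - (s - t) * (- r ^ 2 * exp (- (r ^ 2 * t)))))) by (rewrite pow_add; ring).
    replace ((s - t) ^ 2 * (r ^ (p + 4) * exp (- (r ^ 2 * (t / 2))))) with
      (1 * (r ^ p * ((s - t) ^ 2 * (r ^ 4 * exp (- (r ^ 2 * (t / 2))))))) by (rewrite pow_add; ring).
    rewrite Rabs_mult; apply Rmult_le_compat; try apply Rabs_pos; [apply sin_abs_le_1|].
    rewrite Rabs_mult, (Rabs_pos_eq (r ^ p)) by now apply pow_le.
    apply Rmult_le_compat_l; [now apply pow_le|].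
    apply (taylor_abs_le (fun s => exp (- (r ^ 2 * s))) (fun s => - r ^ 2 * exp (- (r ^ 2 * s)))
      (fun s => r ^ 4 * exp (- (r ^ 2 * s)))).
    + intros c; auto_derive; trivial; simpl; ring.
    + intros c; auto_derive; trivial; simpl; ring.
    + intros c Hc.
      assert (t / 2 <= c) by (revert Hc; unfold Rmin, Rmax; destruct Rle_dec; lra).
      rewrite Rabs_pos_eq by (apply Rmult_le_pos; [now apply pow_le|left; apply exp_pos]).
      apply Rmult_le_compat_l; [now apply pow_le|].
      apply exp_le_exp, Ropp_le_contravar, Rmult_le_compat_l; auto; apply pow2_ge_0.
Qed.

(** Integration by parts: e^(-r^2 t) sin(r x), which is [sin_moment 0], vanishes at 0 and at
    infinity, and its derivative is e^(-r^2 t) (x cos(r x) - 2 r t sin(r x)). *)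
Lemma sin_moment_1_cos_moment_0 (x t : R) : 0 < t ->
  half_int (sin_moment 1 x t) = x / (2 * t) * half_int (cos_moment 0 x t).
Proof.
  intros Ht; apply half_int_unique.
  apply (is_lim_ext (fun b => x / (2 * t) * RInt (cos_moment 0 x t) 0 b
                              - / (2 * t) * sin_moment 0 x t b)).
  - intros b; symmetry; apply is_RInt_unique.
    apply (is_RInt_ext (fun r => x / (2 * t) * cos_moment 0 x t r -
      / (2 * t) * (exp (- (r ^ 2 * t)) * (x * cos (r * x) - 2 * r * t * sin (r * x))))).
    + intros r _; unfold cos_moment, sin_moment; simpl; field; lra.
    + apply (is_RInt_minus (fun r => x / (2 * t) * cos_moment 0 x t r)
        (fun r => / (2 * t) * (exp (- (r ^ 2 * t)) * (x * cos (r * x) - 2 * r * t * sin (r * x))))).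
      * apply (is_RInt_scal (cos_moment 0 x t)).
        apply (RInt_correct (V := R_CompleteNormedModule)), continuous_ex_RInt.
        now apply exp_decay_cos_moment.
      * apply (is_RInt_scal (fun r => exp (- (r ^ 2 * t)) * (x * cos (r * x) - 2 * r * t * sin (r * x)))).
        replace (sin_moment 0 x t b) with (sin_moment 0 x t b - sin_moment 0 x t 0)
          by (unfold sin_moment; rewrite Rmult_0_l, sin_0; ring).
        apply (is_RInt_derive_all (sin_moment 0 x t)).
        -- intros r; unfold sin_moment; auto_derive; trivial; simpl; ring.
        -- intros r; apply ex_derive_continuous_R; auto_derive; trivial.
  - evar_last.
    + apply is_lim_minus'.
      * apply (is_lim_scal_l _ (x / (2 * t)) _ (half_int (cos_moment 0 x t))).
        now apply exp_decay_half_int, exp_decay_cos_moment.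
      * apply (is_lim_scal_l _ (/ (2 * t)) _ 0).
        now apply exp_decay_lim, exp_decay_sin_moment.
    + simpl; f_equal; ring.
Qed.

(** By the previous identity, c(y) = [half_int (cos_moment 0 y t)] satisfies c' = - y / (2 t) c. So
    its product [F] with e^(y^2 / (4 t)) is constant, and F 0 is the plain Gaussian integral. *)
Lemma cos_moment_0_value (x t : R) : 0 < t ->
  half_int (cos_moment 0 x t) = sqrt PI / (2 * sqrt t) * exp (- (x ^ 2 / (4 * t))).
Proof.
  intros Ht.
  pose (F := fun y => half_int (cos_moment 0 y t) * exp (y ^ 2 / (4 * t))).
  assert (HF : forall y, is_derive F y 0).
  { intros y; unfold F; evar_last.
    - apply (is_derive_mult (fun y => half_int (cos_moment 0 y t)) (fun y => exp (y ^ 2 / (4 * t)))).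
      + now apply is_derive_cos_moment_x.
      + auto_derive; [lra|reflexivity].
      + intros; apply Rmult_comm.
    - rewrite sin_moment_1_cos_moment_0 by auto.
      unfold plus, mult; simpl; unfold Rdiv; field; lra. }
  assert (H0 : F 0 = sqrt PI / (2 * sqrt t)).
  { unfold F; unfold Rdiv at 1; rewrite pow_i, Rmult_0_l, exp_0, Rmult_1_r by lia.
    apply half_int_unique.
    apply (is_half_int_ext (fun r => exp (- (r ^ 2 * t)))); [|now apply is_half_int_gauss].
    intros r _; unfold cos_moment; rewrite Rmult_0_r, cos_0; ring. }
  assert (E : F x = F 0).
  { destruct (Rtotal_order x 0) as [H | [-> | H]]; auto.
    - apply (eq_is_derive F); auto.
    - symmetry; apply (eq_is_derive F); auto. }
  rewrite <- H0, <- E; unfold F.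
  rewrite Rmult_assoc, <- exp_plus, Rplus_opp_r, exp_0; ring.
Qed.

Lemma sin_moment_1_value (x t : R) : 0 < t ->
  half_int (sin_moment 1 x t) = sqrt PI / 4 * x * heat_profile x t.
Proof.
  intros Ht; rewrite sin_moment_1_cos_moment_0, cos_moment_0_value by auto.
  unfold heat_profile.
  replace (- x ^ 2 / (4 * t)) with (- (x ^ 2 / (4 * t))) by (unfold Rdiv; ring).
  assert (Hs := sqrt_lt_R0 t Ht); field; lra.
Qed.

(** * Reduction of the complex integrals *)

(* The junk value [D 0 / 0 = 0] is the continuous extension. *)
Lemma continuous_div_id (D : R -> R) (C : R) : (forall r, continuous D r) ->
  (forall r, Rabs (D r) <= C * r ^ 2) -> forall r, continuous (fun r => D r / r) r.
Proof.
  intros HD H r; destruct (Req_dec r 0) as [-> | Hr].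
  - assert (D0 : D 0 = 0).
    { specialize (H 0); rewrite pow_i, Rmult_0_r in H by lia.
      apply Rabs_eq_0, Rle_antisym; auto; apply Rabs_pos. }
    assert (HC : 0 < Rabs C + 1) by (generalize (Rabs_pos C); lra).
    apply filterlim_locally; intros eps.
    assert (He : 0 < eps / (Rabs C + 1)) by (apply Rdiv_lt_0_compat; auto; apply cond_pos).
    exists (mkposreal _ He); intros y Hy.
    change (Rabs (y - 0) < eps / (Rabs C + 1)) in Hy.
    change (Rabs (D y / y - D 0 / 0) < eps).
    rewrite D0; unfold Rdiv at 2; rewrite Rmult_0_l, Rminus_0_r.
    rewrite Rminus_0_r in Hy.
    destruct (Req_dec y 0) as [-> | Hy0].
    { rewrite D0; unfold Rdiv; rewrite Rmult_0_l, Rabs_R0; apply cond_pos. }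
    assert (Hp : 0 < Rabs y) by now apply Rabs_pos_lt.
    unfold Rdiv; rewrite Rabs_mult, Rabs_inv.
    apply Rmult_lt_reg_r with (Rabs y); auto.
    rewrite Rmult_assoc, Rinv_l, Rmult_1_r by lra.
    eapply Rle_lt_trans; [apply H|].
    rewrite <- (pow2_abs y).
    apply Rle_lt_trans with ((Rabs C + 1) * Rabs y * Rabs y).
    { generalize (Rle_abs C) (pow2_ge_0 (Rabs y)); nra. }
    apply Rmult_lt_compat_r; auto.
    apply Rmult_lt_compat_l with (r := Rabs C + 1) in Hy; auto.
    replace ((Rabs C + 1) * (eps / (Rabs C + 1))) with (pos eps) in Hy by (field; lra); lra.
  - apply (continuous_mult D Rinv); auto; apply continuous_Rinv; auto.
Qed.

(** Together with [v_integrand_im], the components of the contour integrand on z = r (1 + i), r > 0: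
    there dz / z = dr / r and z^2 = 2 i r^2, so e^(-z^2 t) only shifts the phase. *)
Definition v_integrand_re (x t r : R) : R :=
  exp (- (x * r)) * ((cos (r * x - 2 * r ^ 2 * t) - cos (r * x)) / r).

Definition v_integrand_im (x t r : R) : R :=
  exp (- (x * r)) * ((sin (r * x - 2 * r ^ 2 * t) - sin (r * x)) / r).

(** The quadratic bound on [D] cancels the 1 / r and leaves a multiple of r e^(-x r); at r = 0 it
    forces [D 0 = 0]. *)
Lemma exp_decay_div_id (x C : R) (D : R -> R) : 0 < x -> (forall r, continuous D r) ->
  (forall r, Rabs (D r) <= C * r ^ 2) -> exp_decay (fun r => exp (- (x * r)) * (D r / r)).
Proof.
  intros Hx HD H; apply exp_decay_le with (fun r => C * (r ^ 1 * exp (- (x * r)))).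
  - intros r; apply (continuous_mult (fun r => exp (- (x * r))) (fun r => D r / r)).
    + apply ex_derive_continuous_R; auto_derive; trivial.
    + now apply continuous_div_id with C.
  - intros r Hr.
    replace (C * (r ^ 1 * exp (- (x * r)))) with (exp (- (x * r)) * (C * r)) by ring.
    rewrite !Rabs_mult; apply Rmult_le_compat_l; [apply Rabs_pos|].
    destruct Hr as [Hr | <-].
    + unfold Rdiv; rewrite Rabs_mult, Rabs_inv.
      assert (Hp : 0 < Rabs r) by (apply Rabs_pos_lt; lra).
      apply Rmult_le_reg_r with (Rabs r); auto.
      rewrite Rmult_assoc, Rinv_l, Rmult_1_r by lra.
      eapply Rle_trans; [apply H|].
      replace (Rabs C * Rabs r * Rabs r) with (Rabs C * Rabs r ^ 2) by ring.
      rewrite pow2_abs; apply Rmult_le_compat_r; [apply pow2_ge_0|apply Rle_abs].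
    + specialize (H 0); rewrite pow_i, Rmult_0_r in H by lia.
      replace (D 0) with 0.
      * unfold Rdiv; rewrite Rmult_0_l, Rabs_R0, Rmult_0_r; lra.
      * symmetry; apply Rabs_eq_0, Rle_antisym; auto; apply Rabs_pos.
  - now apply exp_decay_scal, exp_decay_mult_pow, exp_decay_exp.
Qed.

Lemma exp_decay_v_integrand_re (x t : R) : 0 < x -> exp_decay (v_integrand_re x t).
Proof.
  intros Hx; apply (exp_decay_div_id x (2 * Rabs t)); auto.
  - intros r; apply ex_derive_continuous_R; auto_derive; trivial.
  - intros r; eapply Rle_trans; [apply cos_lipschitz|].
    replace (r * x - 2 * r ^ 2 * t - r * x) with (- (2 * r ^ 2 * t)) by ring.
    rewrite Rabs_Ropp, !Rabs_mult, (Rabs_pos_eq 2), (Rabs_pos_eq (r ^ 2)) by (try apply pow2_ge_0; lra); lra.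
Qed.

Lemma exp_decay_v_integrand_im (x t : R) : 0 < x -> exp_decay (v_integrand_im x t).
Proof.
  intros Hx; apply (exp_decay_div_id x (2 * Rabs t)); auto.
  - intros r; apply ex_derive_continuous_R; auto_derive; trivial.
  - intros r; eapply Rle_trans; [apply sin_lipschitz|].
    replace (r * x - 2 * r ^ 2 * t - r * x) with (- (2 * r ^ 2 * t)) by ring.
    rewrite Rabs_Ropp, !Rabs_mult, (Rabs_pos_eq 2), (Rabs_pos_eq (r ^ 2)) by (try apply pow2_ge_0; lra); lra.
Qed.

Lemma sector_1 (x t r : R) :
  sector x t 1 r = 2 * (r ^ 1 * exp (- (x * r)) * cos (r * x - 2 * r ^ 2 * t)).
Proof.
  unfold sector, sector_exp, sector_phase; rewrite !Rmult_1_r.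
  replace (r * x + r ^ 2 * t * (1 - 1 ^ 2)) with (x * r) by ring; ring.
Qed.

Lemma sector_0 (x t r : R) : sector x t 0 r = sin_moment 1 x t r.
Proof.
  unfold sector, sector_exp, sector_phase, sin_moment; rewrite !Rmult_0_r.
  replace (0 * x + r ^ 2 * t * (1 - 0 ^ 2)) with (r ^ 2 * t) by ring.
  rewrite Rminus_0_r; ring.
Qed.

Lemma exp_decay_sector_1 (x t : R) : 0 < x -> exp_decay (sector x t 1).
Proof.
  intros Hx.
  apply (exp_decay_ext (fun r => 2 * (r ^ 1 * exp (- (x * r)) * cos (r * x - 2 * r ^ 2 * t)))).
  { intros r; symmetry; apply sector_1. }
  apply exp_decay_scal, (exp_decay_mult_bounded _ (fun r => cos (r * x - 2 * r ^ 2 * t))).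
  - intros r; apply ex_derive_continuous_R; auto_derive; trivial.
  - intros; apply cos_abs_le_1.
  - now apply exp_decay_mult_pow, exp_decay_exp.
Qed.

(** The t-derivative of the integrand is - [sector x t 1], free of the denominator r; the rotation
    to s = 0 then turns its integral into that of [sin_moment 1]. *)
Lemma is_derive_v_integrand_im (x t : R) : 0 < x -> 0 < t ->
  is_derive (fun s => half_int (v_integrand_im x s)) t (- half_int (sin_moment 1 x t)).
Proof.
  intros Hx Ht.
  replace (- half_int (sin_moment 1 x t)) with (half_int (fun r => -1 * sector x t 1 r)).
  2:{ rewrite half_int_scal by now apply exp_decay_sector_1.
      replace (half_int (sector x t 1)) with (half_int (sin_moment 1 x t)); [ring|].
      apply half_int_unique, (is_half_int_ext (sector x t 0)); [intros; apply sector_0|].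
      now apply is_half_int_sector, exp_decay_half_int, exp_decay_sector_1. }
  (* The phase r x - 2 r^2 t changes by 2 r^2 (s - t); its square divided by r gives 4 r^3 (s -
     t)^2. *)
  apply is_derive_half_int with (g := fun r => 4 * (r ^ 3 * exp (- (x * r)))) (d := 1); [lra| | | |].
  - intros s _; now apply exp_decay_v_integrand_im.
  - now apply exp_decay_scal, exp_decay_sector_1.
  - now apply exp_decay_scal, exp_decay_mult_pow, exp_decay_exp.
  - intros s r _ [Hr | <-].
    + rewrite sector_1; unfold v_integrand_im.
      set (a := r * x - 2 * r ^ 2 * t); set (b := r * x - 2 * r ^ 2 * s).
      replace (_ - _ - _) with (exp (- (x * r)) / r * (sin b - sin a - (b - a) * cos a))
        by (unfold a, b; field; lra).
      replace ((s - t) ^ 2 * (4 * (r ^ 3 * exp (- (x * r)))))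
        with (exp (- (x * r)) / r * (b - a) ^ 2) by (unfold a, b; field; lra).
      assert (0 < exp (- (x * r)) / r) by (apply Rdiv_lt_0_compat; auto; apply exp_pos).
      rewrite Rabs_mult, Rabs_pos_eq by lra.
      apply Rmult_le_compat_l; [lra|apply sin_taylor].
    + rewrite sector_1; unfold v_integrand_im.
      replace (0 * x - 2 * 0 ^ 2 * s) with (0 * x) by ring.
      replace (0 * x - 2 * 0 ^ 2 * t) with (0 * x) by ring.
      unfold Rdiv; rewrite Rminus_diag, pow_i, !Rmult_0_l, !Rmult_0_r by lia.
      rewrite Rminus_diag, Rabs_R0; apply Req_le; ring.
Qed.

(** The real part of [f] is odd and the imaginary part even. As the two endpoints move
    independently, symmetry alone does not cancel the real parts: each half must converge, and then
    LA - LA = 0. Nothing is assumed about [f 0], so the corner of the contour and its derivative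
    there do not matter. *)
Lemma is_RInt_gen_reflect (f : R -> C) (A B : R -> R) (LA LB : R) :
  (forall r, continuous A r) -> (forall r, continuous B r) ->
  (forall r, 0 < r -> f r = (A r, B r)) -> (forall r, 0 < r -> f (- r) = (- A r, B r)) ->
  is_half_int A LA -> is_half_int B LB ->
  is_RInt_gen (V := C_R_NormedModule) f (Rbar_locally m_infty) (Rbar_locally p_infty)
    ((0, 2 * LB) : C).
Proof.
  intros HA HB Hp Hm HLA HLB.
  pose (GA := fun b => RInt A 0 b); pose (GB := fun b => RInt B 0 b).
  assert (IA : forall b, is_RInt A 0 b (GA b)).
  { intros b; apply (RInt_correct (V := R_CompleteNormedModule)), continuous_ex_RInt, HA. }
  assert (IB : forall b, is_RInt B 0 b (GB b)).
  { intros b; apply (RInt_correct (V := R_CompleteNormedModule)), continuous_ex_RInt, HB. }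
  apply (filterlimi_lim_ext_loc
    (fun ab : R * R => (GA (snd ab) - GA (- fst ab), GB (snd ab) + GB (- fst ab)) : C)).
  - apply (Filter_prod _ _ _ (fun a => a < 0) (fun b => 0 < b)); [exists 0; auto|exists 0; auto|].
    intros a b Ha Hb; simpl.
    replace ((GA b - GA (- a), GB b + GB (- a)) : C)
      with (plus (G := C_R_NormedModule) ((- GA (- a), GB (- a)) : C) ((GA b, GB b) : C)).
    2:{ change (@eq C (- GA (- a) + GA b, GB (- a) + GB b) (GA b - GA (- a), GB b + GB (- a))).
        apply injective_projections; simpl; ring. }
    apply (is_RInt_Chasles (V := C_R_NormedModule)) with 0.
    + apply (is_RInt_ext (V := C_R_NormedModule) (fun r => ((- A (- r), B (- r)) : C))).
      { rewrite Rmin_left, Rmax_right by lra; intros r Hr.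
        rewrite <- Hm, Ropp_involutive by lra; reflexivity. }
      apply (is_RInt_fct_extend_pair (U := R_NormedModule) (V := R_NormedModule)); simpl.
      * apply (is_RInt_comp_opp A); rewrite Ropp_0.
        apply (is_RInt_swap A), IA.
      * apply (is_RInt_ext (fun r => opp (- B (- r)))).
        { intros r _; apply Ropp_involutive. }
        apply (is_RInt_comp_opp (fun r => - B r)); rewrite Ropp_0.
        replace (GB (- a)) with (opp (- GB (- a))) by apply Ropp_involutive.
        apply (is_RInt_swap (fun r => - B r)), (is_RInt_opp B), IB.
    + apply (is_RInt_ext (V := C_R_NormedModule) (fun r => ((A r, B r) : C))).
      { rewrite Rmin_left, Rmax_right by lra; intros r Hr; symmetry; apply Hp; lra. }
      apply (is_RInt_fct_extend_pair (U := R_NormedModule) (V := R_NormedModule)); simpl; auto.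
  - assert (Fs : forall G l, filterlim G (Rbar_locally p_infty) (locally l) ->
      filterlim (fun ab : R * R => G (snd ab))
        (filter_prod (Rbar_locally m_infty) (Rbar_locally p_infty)) (locally (l : R))).
    { intros G l H; apply (filterlim_comp _ _ _ snd G _ (Rbar_locally p_infty)); auto.
      apply filterlim_snd. }
    assert (Ff : forall G l, filterlim G (Rbar_locally p_infty) (locally l) ->
      filterlim (fun ab : R * R => G (- fst ab))
        (filter_prod (Rbar_locally m_infty) (Rbar_locally p_infty)) (locally (l : R))).
    { intros G l H; apply (filterlim_comp _ _ _ (fun ab => - fst ab) G _ (Rbar_locally p_infty)); auto.
      apply (filterlim_comp _ _ _ fst Ropp _ (Rbar_locally m_infty)); [apply filterlim_fst|].
      apply (filterlim_Rbar_opp m_infty). }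
    intros P [eps HP].
    assert (LA' := Fs GA LA HLA); assert (LB' := Fs GB LB HLB).
    assert (LA'' := Ff GA LA HLA); assert (LB'' := Ff GB LB HLB).
    pose (e := pos_div_2 eps).
    specialize (LA' _ (locally_ball LA e)); specialize (LB' _ (locally_ball LB e)).
    specialize (LA'' _ (locally_ball LA e)); specialize (LB'' _ (locally_ball LB e)).
    unfold filtermap in *.
    generalize (filter_and _ _ (filter_and _ _ LA' LB') (filter_and _ _ LA'' LB'')).
    apply filter_imp; intros [a b] [[H1 H2] [H3 H4]]; simpl in H1, H2, H3, H4.
    assert (E : pos eps = e + e) by (simpl; field).
    unfold ball in H1, H2, H3, H4; simpl in H1, H2, H3, H4; unfold AbsRing_ball in *; simpl in *.
    unfold abs, minus, plus, opp in *; simpl in *.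
    apply HP; split; unfold ball; simpl; unfold AbsRing_ball, abs, minus, plus, opp; simpl;
      apply Rabs_lt_between in H1, H2, H3, H4; apply Rabs_lt_between; lra.
Qed.

Lemma line_integrand_v_pos (x t r : R) : 0 < r ->
  line_integrand (v_integrand x t) gamma r = (v_integrand_re x t r, v_integrand_im x t r).
Proof.
  intros Hr; unfold line_integrand.
  replace (CDerive_n gamma 1 r) with ((1, 1) : C).
  2:{ unfold CDerive_n, gamma, Re, Im; simpl; f_equal; symmetry.
      - apply Derive_id.
      - rewrite (Derive_ext_loc Rabs (fun r => r)); [apply Derive_id|].
        apply (locally_open (fun r => 0 < r)); [apply open_gt| |exact Hr].
        intros y Hy; apply Rabs_pos_eq; lra. }
  unfold v_integrand, gamma; rewrite Rabs_pos_eq by lra.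
  replace (Ci * (r, r) * x - (r, r) ^ 2 * t)%C with ((- (x * r), r * x - 2 * r ^ 2 * t) : C)
    by (apply injective_projections; simpl; ring).
  replace (Ci * (r, r) * x)%C with ((- (x * r), r * x) : C)
    by (apply injective_projections; simpl; ring).
  unfold Cexp, v_integrand_re, v_integrand_im; simpl Re; simpl Im.
  apply injective_projections; simpl; field; nra.
Qed.

Lemma line_integrand_v_neg (x t r : R) : 0 < r ->
  line_integrand (v_integrand x t) gamma (- r) = (- v_integrand_re x t r, v_integrand_im x t r).
Proof.
  intros Hr; unfold line_integrand.
  replace (CDerive_n gamma 1 (- r)) with ((1, -1) : C).
  2:{ unfold CDerive_n, gamma, Re, Im; simpl; f_equal; symmetry.
      - apply Derive_id.
      - rewrite (Derive_ext_loc Rabs Ropp); [rewrite Derive_opp, Derive_id; ring|].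
        apply (locally_open (fun r => r < 0)); [apply open_lt| |lra].
        intros y Hy; apply Rabs_left; lra. }
  unfold v_integrand, gamma; rewrite Rabs_Ropp, Rabs_pos_eq by lra.
  replace (Ci * (Ropp r, r) * x - (Ropp r, r) ^ 2 * t)%C
    with ((- (x * r), - (r * x - 2 * r ^ 2 * t)) : C)
    by (apply injective_projections; simpl; ring).
  replace (Ci * (Ropp r, r) * x)%C with ((- (x * r), - (r * x)) : C)
    by (apply injective_projections; simpl; ring).
  unfold Cexp, v_integrand_re, v_integrand_im; simpl Re; simpl Im.
  rewrite !cos_neg, !sin_neg.
  apply injective_projections; simpl; field; nra.
Qed.

Lemma is_path_int_v (x t : R) : 0 < x ->
  is_RInt_gen (V := C_R_NormedModule) (line_integrand (v_integrand x t) gamma)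
    (Rbar_locally m_infty) (Rbar_locally p_infty) ((0, 2 * half_int (v_integrand_im x t)) : C).
Proof.
  intros Hx; apply is_RInt_gen_reflect with (v_integrand_re x t) (v_integrand_im x t) (half_int (v_integrand_re x t)).
  - now apply exp_decay_v_integrand_re.
  - now apply exp_decay_v_integrand_im.
  - intros; now apply line_integrand_v_pos.
  - intros; now apply line_integrand_v_neg.
  - now apply exp_decay_half_int, exp_decay_v_integrand_re.
  - now apply exp_decay_half_int, exp_decay_v_integrand_im.
Qed.

Lemma v_half_int (x t : R) : 0 < x -> v x t = RtoC (- (2 / PI) * half_int (v_integrand_im x t)).
Proof.
  intros Hx; unfold v, path_int.
  rewrite (is_RInt_gen_unique (V := C_R_CompleteNormedModule) _ _ (is_path_int_v x t Hx)).
  assert (HP := PI_RGT_0).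
  apply injective_projections; simpl; field; lra.
Qed.

Lemma u_integrand_trig (n : nat) (x t r : R) : u_integrand n x t r =
  ((-1) ^ (n - 1) * cos_moment (2 * (n - 1) + 1) x t r,
   (-1) ^ (n - 1) * sin_moment (2 * (n - 1) + 1) x t r).
Proof.
  unfold u_integrand.
  replace (- RtoC r ^ 2)%C with (RtoC (-1 * r ^ 2))
    by (apply injective_projections; simpl; ring).
  rewrite <- RtoC_pow, Rpow_mult_distr, <- pow_mult.
  replace (Ci * r * x - r ^ 2 * t)%C with ((- (r ^ 2 * t), r * x) : C)
    by (apply injective_projections; simpl; ring).
  unfold Cexp, cos_moment, sin_moment; rewrite pow_add.
  apply injective_projections; simpl; ring.
Qed.

(** The exponent 2 (n - 1) + 1 is odd, which makes [cos_moment] odd and [sin_moment] even in r, as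
    the reflection lemma requires. *)
Lemma is_RInt_gen_u_integrand (n : nat) (x t : R) : 0 < t ->
  is_RInt_gen (V := C_R_NormedModule) (u_integrand n x t)
    (Rbar_locally m_infty) (Rbar_locally p_infty)
    ((0, 2 * ((-1) ^ (n - 1) * half_int (sin_moment (2 * (n - 1) + 1) x t))) : C).
Proof.
  intros Ht; rewrite <- half_int_scal by now apply exp_decay_sin_moment.
  assert (Hc := exp_decay_scal _ ((-1) ^ (n - 1)) (exp_decay_cos_moment (2 * (n - 1) + 1) x t Ht)).
  assert (Hs := exp_decay_scal _ ((-1) ^ (n - 1)) (exp_decay_sin_moment (2 * (n - 1) + 1) x t Ht)).
  eapply is_RInt_gen_reflect; [apply Hc|apply Hs| | | |].
  - intros r _; apply u_integrand_trig.
  - intros r _; rewrite u_integrand_trig; unfold cos_moment, sin_moment.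
    rewrite !pow_add, !pow_mult, !Ropp_mult_distr_l_reverse, sin_neg, cos_neg.
    replace ((- r) ^ 2) with (r ^ 2) by ring.
    apply injective_projections; simpl; ring.
  - apply exp_decay_half_int, Hc.
  - apply exp_decay_half_int, Hs.
Qed.

(** * The initial-boundary-value problem *)

(** The real-axis formula for [u n], n >= 1. Unlike the contour integral it makes sense for every
    real x when t > 0, so the boundary limit becomes continuity at x = 0. *)
Definition u_real (n : nat) (x t : R) : R :=
  2 / PI * ((-1) ^ (n - 1) * half_int (sin_moment (2 * (n - 1) + 1) x t)).

Lemma is_derive_u_real_t (n : nat) (x t : R) : (1 <= n)%nat -> 0 < t ->
  is_derive (u_real n x) t (u_real (S n) x t).
Proof.
  intros Hn Ht; unfold u_real.
  replace (S n - 1)%nat with (S (n - 1)) by lia.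
  replace (2 * S (n - 1) + 1)%nat with (2 * (n - 1) + 1 + 2)%nat by lia.
  evar_last.
  - apply is_derive_scal, is_derive_scal, is_derive_sin_moment_t, Ht.
  - simpl; ring.
Qed.

Definition u_real_x (n : nat) (x t : R) : R :=
  2 / PI * ((-1) ^ (n - 1) * half_int (cos_moment (S (2 * (n - 1) + 1)) x t)).

Lemma is_derive_u_real_x (n : nat) (x t : R) : 0 < t ->
  is_derive (fun y => u_real n y t) x (u_real_x n x t).
Proof.
  intros Ht; unfold u_real, u_real_x.
  apply is_derive_scal, is_derive_scal, (is_derive_sin_moment_x _ _ _ Ht).
Qed.

Lemma is_derive_u_real_xx (n : nat) (x t : R) : (1 <= n)%nat -> 0 < t ->
  is_derive (fun y => u_real_x n y t) x (u_real (S n) x t).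
Proof.
  intros Hn Ht; unfold u_real, u_real_x.
  replace (S n - 1)%nat with (S (n - 1)) by lia.
  replace (2 * S (n - 1) + 1)%nat with (S (S (2 * (n - 1) + 1))) by lia.
  evar_last.
  - apply is_derive_scal, is_derive_scal, (is_derive_cos_moment_x _ _ _ Ht).
  - simpl; ring.
Qed.

(** * Iterated derivatives on the positive half-line *)

Lemma locally_pos (P : R -> Prop) (t : R) : 0 < t -> (forall s, 0 < s -> P s) -> locally t P.
Proof.
  intros Ht H; apply (locally_open (fun s => 0 < s)); auto; apply open_gt.
Qed.

(** Higher derivatives are identified by exhibiting all of them at once as a sequence [g]. Each
    induction step replaces [Derive_n f k] by [g k] on a neighbourhood, which is why the hypotheses
    cover every s > 0. *)
Lemma Derive_n_chain (f : R -> R) (g : nat -> R -> R) (N : nat) :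
  (forall s, 0 < s -> f s = g 0%nat s) ->
  (forall k s, (k < N)%nat -> 0 < s -> is_derive (g k) s (g (S k) s)) ->
  forall k s, (k <= N)%nat -> 0 < s -> Derive_n f k s = g k s.
Proof.
  intros Hf Hg k; induction k as [|k IH]; intros s Hk Hs; simpl; auto.
  rewrite (Derive_ext_loc _ (g k)).
  - apply is_derive_unique, Hg; auto; lia.
  - apply locally_pos; auto; intros r Hr; apply IH; auto; lia.
Qed.

Lemma ex_Derive_n_near_chain (f : R -> R) (g : nat -> R -> R) (N : nat) :
  (forall s, 0 < s -> f s = g 0%nat s) ->
  (forall k s, (k < N)%nat -> 0 < s -> is_derive (g k) s (g (S k) s)) ->
  forall s, 0 < s -> ex_Derive_n_near f N s.
Proof.
  intros Hf Hg s Hs; apply locally_pos; auto; intros r Hr [|k] Hk; simpl; auto.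
  apply (ex_derive_ext_loc (g k)).
  - apply locally_pos; auto; intros y Hy; symmetry; apply (Derive_n_chain f g N); auto; lia.
  - eexists; apply Hg; auto.
Qed.

Lemma CDerive_n_chain (f : R -> C) (g : nat -> R -> R) (N : nat) :
  (forall s, 0 < s -> f s = RtoC (g 0%nat s)) ->
  (forall k s, (k < N)%nat -> 0 < s -> is_derive (g k) s (g (S k) s)) ->
  forall s, 0 < s -> CDerive_n f N s = RtoC (g N s) /\ ex_CDerive_n f N s.
Proof.
  intros Hf Hg s Hs.
  assert (Hr : forall s, 0 < s -> Re (f s) = g 0%nat s) by (intros r Hr; now rewrite Hf).
  assert (Hi : forall s, 0 < s -> Im (f s) = 0) by (intros r Hr'; now rewrite Hf).
  assert (H0 : forall s : R, is_derive (fun _ => 0) s 0)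
    by (intros; apply (is_derive_const (V := R_NormedModule))).
  split; [unfold CDerive_n, RtoC; f_equal|split].
  - now apply (Derive_n_chain _ g N).
  - now apply (Derive_n_chain _ (fun _ _ => 0) N).
  - now apply (ex_Derive_n_near_chain _ g N).
  - now apply (ex_Derive_n_near_chain _ (fun _ _ => 0) N).
Qed.

Definition v_real (x t : R) : R := - (2 / PI) * half_int (v_integrand_im x t).

(** Order 0 needs its own case: because of truncated subtraction, [u_real 0] coincides with
    [u_real 1], not with [v]. *)
Definition v_chain (x : R) (k : nat) : R -> R := match k with O => v_real x | S _ => u_real k x end.

Lemma is_derive_v_chain (x t : R) (k : nat) : 0 < x -> 0 < t ->
  is_derive (v_chain x k) t (v_chain x (S k) t).
Proof.
  intros Hx Ht; destruct k as [|k]; simpl; [|apply is_derive_u_real_t; auto; lia].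
  unfold v_real, u_real; evar_last; [now apply is_derive_scal, is_derive_v_integrand_im|].
  simpl; ring.
Qed.

Lemma CDerive_n_v (n : nat) (x t : R) : (1 <= n)%nat -> 0 < x -> 0 < t ->
  u n x t = RtoC (u_real n x t) /\ ex_CDerive_n (v x) n t.
Proof.
  intros Hn Hx Ht; unfold u.
  replace (u_real n x t) with (v_chain x n t) by (destruct n; [lia|reflexivity]).
  apply CDerive_n_chain; auto.
  - intros s Hs; now apply v_half_int.
  - intros k s _ Hs; now apply is_derive_v_chain.
Qed.

Lemma u_real_1 (x t : R) : 0 < t -> u_real 1 x t = x / (2 * sqrt PI) * heat_profile x t.
Proof.
  intros Ht; unfold u_real; simpl; rewrite sin_moment_1_value by auto.
  assert (HP := PI_RGT_0); assert (Hs := sqrt_lt_R0 PI HP).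
  rewrite <- (sqrt_sqrt PI) at 1 by lra; field; lra.
Qed.

(** Reading [u_real_1] backwards, [heat_profile] is a multiple of [u_real 1], so its t-derivatives
    exist and are multiples of the later [u_real], with no differentiation of the closed form. *)
Lemma heat_profile_chain (x : R) : 0 < x ->
  let g := fun k t => 2 * sqrt PI / x * u_real (S k) x t in
  (forall t, 0 < t -> heat_profile x t = g 0%nat t) /\
  (forall k t, 0 < t -> is_derive (g k) t (g (S k) t)).
Proof.
  intros Hx g; unfold g; split.
  - intros t Ht; rewrite u_real_1 by auto.
    assert (Hs := sqrt_lt_R0 PI PI_RGT_0); field; lra.
  - intros k t Ht; apply is_derive_scal, is_derive_u_real_t; auto; lia.
Qed.

Lemma u_real_heat_profile (n : nat) (x t : R) : (1 <= n)%nat -> 0 < x -> 0 < t ->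
  u_real n x t = x / (2 * sqrt PI) * Derive_n (heat_profile x) (n - 1) t /\
  ex_Derive_n_near (heat_profile x) (n - 1) t.
Proof.
  intros Hn Hx Ht; destruct (heat_profile_chain x Hx) as [H0 H1].
  pose (g := fun k t => 2 * sqrt PI / x * u_real (S k) x t).
  split; [|apply (ex_Derive_n_near_chain _ g); unfold g; auto].
  rewrite (Derive_n_chain _ g (n - 1)); unfold g; auto.
  replace (S (n - 1)) with n by lia.
  assert (Hs := sqrt_lt_R0 PI PI_RGT_0); field; lra.
Qed.

(* A span closed under [d/dt] all of whose elements vanish as [t] tends to [0+]. *)
Inductive flat (x : R) : (R -> R) -> Prop :=
| flat_heat_profile j : flat x (fun t => (/ t) ^ j * heat_profile x t)
| flat_lin f g c : flat x f -> flat x g -> flat x (fun t => f t + c * g t).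

Lemma is_derive_heat_profile (x t : R) : 0 < t ->
  is_derive (heat_profile x) t ((x ^ 2 / 4 * (/ t) ^ 2 - 3 / 2 * / t) * heat_profile x t).
Proof.
  intros Ht; assert (Hs := sqrt_lt_R0 t Ht); unfold heat_profile; auto_derive.
  - repeat split; auto; try lra; apply Rgt_not_eq, Rmult_lt_0_compat; lra.
  - assert (E := sqrt_sqrt t (Rlt_le _ _ Ht)).
    set (e := exp _); clearbody e.
    set (q := sqrt t) in *; clearbody q; rewrite <- E; field; lra.
Qed.

Lemma flat_derive (x : R) (f : R -> R) : flat x f ->
  exists f', flat x f' /\ forall t, 0 < t -> is_derive f t (f' t).
Proof.
  induction 1 as [j | f g c _ (f' & Hf' & Hf) _ (g' & Hg' & Hg)].
  (* The true coefficient of (1 / t)^(j + 1) is -(j + 3/2). As [flat_lin] leaves its first function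
     unscaled, this is written as 1 - (j + 5/2). *)
  - exists (fun t => ((/ t) ^ (j + 1) * heat_profile x t +
      (- (INR j + 5 / 2)) * ((/ t) ^ (j + 1) * heat_profile x t)) +
      x ^ 2 / 4 * ((/ t) ^ (j + 2) * heat_profile x t)); split.
    + apply flat_lin; [apply (flat_lin x (fun t => (/ t) ^ (j + 1) * heat_profile x t)
        (fun t => (/ t) ^ (j + 1) * heat_profile x t))|]; apply flat_heat_profile.
    + intros t Ht; evar_last.
      * apply (is_derive_mult (fun t => (/ t) ^ j) (heat_profile x)).
        -- apply is_derive_pow, is_derive_inv; [apply is_derive_id|lra].
        -- now apply is_derive_heat_profile.
        -- intros; apply Rmult_comm.
      * unfold plus, mult, one; simpl; rewrite !pow_add; destruct j; simpl; field; lra.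
  - exists (fun t => f' t + c * g' t); split; [now apply flat_lin|].
    intros t Ht; apply (is_derive_plus f (fun t => c * g t)); auto.
    apply is_derive_scal; auto.
Qed.

(** For t < 1, t^2 <= t sqrt t, so a generator lies between 0 and r^(j + 2) e^(-x^2 r / 4) with r =
    1 / t. The limit at 0+ thus becomes the decay of an exponential at infinity, where x > 0 is
    essential. *)
Lemma flat_lim (x : R) (f : R -> R) : 0 < x -> flat x f -> filterlim f (at_right 0) (locally 0).
Proof.
  intros Hx; induction 1 as [j | f g c _ Hf _ Hg].
  - assert (D : exp_decay (fun r => r ^ (j + 2) * exp (- (x ^ 2 / 4 * r)))).
    { apply exp_decay_mult_pow, exp_decay_exp; nra. }
    assert (L := filterlim_comp _ _ _ Rinv _ _ _ _ filterlim_Rinv_0_right (exp_decay_lim _ D)).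
    apply (filterlim_le_le (F := at_right 0) (fun _ => 0) (fun t => (/ t) ^ j * heat_profile x t)
      (fun t => (/ t) ^ (j + 2) * exp (- (x ^ 2 / 4 * / t))) 0); auto.
    2: apply filterlim_const.
    exists (mkposreal 1 Rlt_0_1); intros t Ht Ht0.
    change (Rabs (t - 0) < 1) in Ht; apply Rabs_lt_between in Ht.
    assert (Hs := sqrt_lt_R0 t Ht0); assert (Hi := Rinv_0_lt_compat t Ht0).
    unfold heat_profile; split.
    + apply Rmult_le_pos; [apply pow_le; lra|].
      apply Rmult_le_pos; [|left; apply exp_pos].
      left; apply Rdiv_lt_0_compat; [lra|]; now apply Rmult_lt_0_compat.
    + rewrite pow_add, Rmult_assoc.
      apply Rmult_le_compat_l; [apply pow_le; lra|].
      replace (- x ^ 2 / (4 * t)) with (- (x ^ 2 / 4 * / t)) by (field; lra).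
      apply Rmult_le_compat_r; [left; apply exp_pos|].
      replace ((/ t) ^ 2) with (1 / (t * t)) by (field; lra).
      apply Rmult_le_compat_l; [lra|].
      apply Rinv_le_contravar; [now apply Rmult_lt_0_compat|].
      assert (E := sqrt_sqrt t (Rlt_le _ _ Ht0)); nra.
  - replace (locally 0) with (locally (0 + c * 0)) by (f_equal; ring).
    apply (filterlim_comp_2 (G := locally 0) (H := locally (c * 0)) f (fun t => c * g t) Rplus); auto.
    + apply (filterlim_comp _ _ _ g (fun y => c * y) _ (locally 0)); auto.
      apply (filterlim_scal_r c 0).
    + apply (filterlim_plus 0 (c * 0)).
Qed.

Lemma Derive_n_heat_profile_flat (x : R) (k : nat) :
  exists f, flat x f /\ forall t, 0 < t -> Derive_n (heat_profile x) k t = f t.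
Proof.
  induction k as [|k (f & Hf & E)].
  - exists (fun t => (/ t) ^ 0 * heat_profile x t); split; [apply flat_heat_profile|].
    intros t _; simpl; ring.
  - destruct (flat_derive x f Hf) as (f' & Hf' & D).
    exists f'; split; auto; intros t Ht; simpl.
    rewrite (Derive_ext_loc _ f); [now apply is_derive_unique, D|now apply locally_pos].
Qed.

Lemma u_real_lim_t (n : nat) (x : R) : (1 <= n)%nat -> 0 < x ->
  filterlim (u_real n x) (at_right 0) (locally 0).
Proof.
  intros Hn Hx; destruct (Derive_n_heat_profile_flat x (n - 1)) as (f & Hf & E).
  apply (filterlim_ext_loc (fun t => x / (2 * sqrt PI) * f t)).
  - exists (mkposreal 1 Rlt_0_1); intros t _ Ht.
    destruct (u_real_heat_profile n x t) as [-> _]; auto; now rewrite E.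
  - replace (locally 0) with (locally (x / (2 * sqrt PI) * 0)) by now rewrite Rmult_0_r.
    apply (filterlim_comp _ _ _ f (fun y => x / (2 * sqrt PI) * y) _ (locally 0)).
    + now apply flat_lim with x.
    + apply (filterlim_scal_r (x / (2 * sqrt PI)) 0).
Qed.

(** [u_real n] is differentiable, hence continuous, in x at 0, and vanishes there because sin(r * 0)
    = 0. *)
Lemma u_real_lim_x (n : nat) (t : R) : 0 < t ->
  filterlim (fun x => u_real n x t) (at_right 0) (locally 0).
Proof.
  intros Ht.
  assert (E : u_real n 0 t = 0).
  { unfold u_real; replace (half_int (sin_moment (2 * (n - 1) + 1) 0 t)) with 0; [ring|symmetry].
    apply half_int_unique, (is_lim_ext (fun _ => 0)); [|apply is_lim_const].
    intros b; symmetry; apply is_RInt_unique, (is_RInt_ext (fun _ => 0)).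
    - intros r _; unfold sin_moment; rewrite Rmult_0_r, sin_0, Rmult_0_r; reflexivity.
    - evar_last; [apply (is_RInt_const (V := R_NormedModule))|].
      apply Rmult_0_r. }
  replace (locally 0) with (locally (u_real n 0 t)) by now rewrite E.
  intros P HP; apply filter_le_within; revert P HP.
  apply (ex_derive_continuous_R (fun x => u_real n x t)); eexists; now apply is_derive_u_real_x.
Qed.

Lemma filterlim_RtoC (f : R -> C) (g : R -> R) :
  (forall s, 0 < s -> f s = RtoC (g s)) ->
  filterlim g (at_right 0) (locally 0) -> filterlim f (at_right 0) (locally (RtoC 0)).
Proof.
  intros E H; apply filterlim_locally; intros eps.
  assert (H' := proj1 (filterlim_locally g 0) H eps).
  apply (filter_imp (fun s => ball 0 eps (g s) /\ 0 < s)).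
  - intros s [Hs Hp]; rewrite E by auto; split; [exact Hs|apply ball_center].
  - apply filter_and; auto; exists (mkposreal 1 Rlt_0_1); auto.
Qed.

Lemma solves_ibvp_u (n : nat) : (1 <= n)%nat -> solves_ibvp (u n).
Proof.
  intros Hn; split; [|split].
  - intros x t Hx Ht.
    destruct (CDerive_n_chain (fun s => u n x s) (fun k => u_real (n + k) x) 1) with t as [Et Dt]; auto.
    + intros s Hs; cbv beta; rewrite Nat.add_0_r; now apply CDerive_n_v.
    + intros k s _ Hs; cbv beta; rewrite Nat.add_succ_r; apply is_derive_u_real_t; auto; lia.
    (* The second x-derivative and the first t-derivative are both [u_real (S n)]: two x-derivatives
       of sin(r x) and one t-derivative of e^(-r^2 t) each produce the factor - r^2. *)
    + destruct (CDerive_n_chain (fun y => u n y t) (fun k y =>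
        match k with O => u_real n y t | 1%nat => u_real_x n y t | _ => u_real (S n) y t end) 2) with x as [Ex Dx]; auto.
      * intros y Hy; now apply CDerive_n_v.
      * intros [|[|k]] y Hk Hy; [now apply is_derive_u_real_x|now apply is_derive_u_real_xx|lia].
      * split; [exact Dt|split; [exact Dx|]].
        rewrite Et, Ex, Nat.add_1_r; reflexivity.
  - intros t Ht; apply filterlim_RtoC with (fun x => u_real n x t).
    + intros x Hx; now apply CDerive_n_v.
    + now apply u_real_lim_x.
  - intros x Hx; apply filterlim_RtoC with (u_real n x).
    + intros t Ht; now apply CDerive_n_v.
    + now apply u_real_lim_t.
Qed.

Lemma solves_ibvp_0 : solves_ibvp (fun _ _ => RtoC 0).
Proof.
  assert (H0 : forall s : R, is_derive (fun _ => 0) s 0)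
    by (intros; apply (is_derive_const (V := R_NormedModule))).
  split; [|split]; try (intros; apply filterlim_const).
  intros x t Hx Ht.
  destruct (CDerive_n_chain (fun _ => RtoC 0) (fun _ _ => 0) 1) with t as [E1 D1]; auto.
  destruct (CDerive_n_chain (fun _ => RtoC 0) (fun _ _ => 0) 2) with x as [E2 D2]; auto.
  split; [exact D1|split; [exact D2|now rewrite E1, E2]].
Qed.

Lemma u_1_neq_0 (x t : R) : 0 < x -> 0 < t -> u 1 x t <> RtoC 0.
Proof.
  intros Hx Ht; destruct (CDerive_n_v 1 x t) as [-> _]; auto.
  rewrite u_real_1 by auto; intros E; apply RtoC_inj in E; revert E; apply Rgt_not_eq.
  assert (Hs := sqrt_lt_R0 PI PI_RGT_0); assert (Hs' := sqrt_lt_R0 t Ht).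
  unfold heat_profile; apply Rmult_lt_0_compat; [apply Rdiv_lt_0_compat; lra|].
  apply Rmult_lt_0_compat; [|apply exp_pos].
  apply Rdiv_lt_0_compat; [lra|]; now apply Rmult_lt_0_compat.
Qed.

Open Scope C_scope.

Theorem mainTheorem3 :
  (forall x t : R, (0 < x)%R -> (0 < t)%R ->
     ex_path_int (v_integrand x t) gamma) /\
  (forall n : nat, (1 <= n)%nat ->
     (forall x t : R, (0 < x)%R -> (0 < t)%R ->
        ex_CDerive_n (v x) n t /\
        ex_RInt_gen (V := C_R_NormedModule) (u_integrand n x t)
          (Rbar_locally m_infty) (Rbar_locally p_infty) /\
        ex_Derive_n_near (heat_profile x) (n - 1) t /\
        u n x t =
          - (Ci / PI) *
            RInt_gen (V := C_R_CompleteNormedModule) (u_integrand n x t)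
              (Rbar_locally m_infty) (Rbar_locally p_infty) /\
        u n x t =
          RtoC (x / (2 * sqrt PI) * Derive_n (heat_profile x) (n - 1) t)%R) /\
     solves_ibvp (u n)) /\
  (exists x t : R, (0 < x)%R /\ (0 < t)%R /\ u 1 x t <> 0) /\
  ~ ibvp_uniquely_solvable.
Proof.
  split; [|split; [|split]].
  - intros x t Hx Ht; eexists; now apply is_path_int_v.
  - intros n Hn; split; [|now apply solves_ibvp_u].
    intros x t Hx Ht.
    destruct (CDerive_n_v n x t Hn Hx Ht) as [Eu Du].
    destruct (u_real_heat_profile n x t Hn Hx Ht) as [EU DU].
    split; [exact Du|split; [|split; [exact DU|split]]].
    + eexists; now apply is_RInt_gen_u_integrand.
    + rewrite Eu, (is_RInt_gen_unique (V := C_R_CompleteNormedModule) _ _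
        (is_RInt_gen_u_integrand n x t Ht)).
      assert (HP := PI_RGT_0); unfold u_real.
      apply injective_projections; simpl; field; lra.
    + now rewrite Eu, EU.
  - exists 1%R, 1%R; split; [exact Rlt_0_1|split; [exact Rlt_0_1|]].
    apply u_1_neq_0; exact Rlt_0_1.
  (* A unique solution [w] would equal both [u 1] and 0 at the point (1, 1). *)
  - intros (w & _ & Hw).
    apply (u_1_neq_0 1 1 Rlt_0_1 Rlt_0_1).
    rewrite (Hw (u 1) (solves_ibvp_u 1 (le_n 1)) _ _ Rlt_0_1 Rlt_0_1).
    symmetry; exact (Hw _ solves_ibvp_0 _ _ Rlt_0_1 Rlt_0_1).
Qed.
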